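(* For $N\ge1$ let $S_N$ be the partial sum operator $S_N\big(\sum_{n=1}^\infty a_nn^{-s}\big):=\sum_{n=1}^Na_nn^{-s}$ acting on $\mathcal{H}^1$. Then $$\log\log N\lesssim\|S_N\|_{\mathcal{H}^1\to\mathcal{H}^1}\lesssim\frac{\log N}{\log\log N},$$ that is, there are absolute constants $c,C>0$ such that $c\log\log N\le\|S_N\|_{\mathcal{H}^1\to\mathcal{H}^1}\le C\log N/\log\log N$ for all sufficiently large $N$.
   Context: $\mathcal{H}^1$ is the closure (completion) of the set of Dirichlet polynomials $f(s)=\sum_{n=1}^Na_nn^{-s}$ under the norm $$\|f\|_{\mathcal{H}^1}:=\lim_{T\to\infty}\frac1{2T}\int_{-T}^T|f(it)|\,dt=\int_{\mathbb{T}^\infty}|\mathcal{B}f(z)|\,d\mu_\infty(z),$$ where $\mu_\infty$ is the normalized product Lebesgue measure on $\mathbb{T}^\infty$ and $\mathcal{B}f(z)=\sum_na_nz^{\kappa(n)}$ is the Bohr lift, $\kappa(n)$ being the exponent vector of $n=p_1^{\kappa_1}p_2^{\kappa_2}\cdots$ in terms of the increasing sequence $(p_j)$ of primes. The coefficient functionals $f\mapsto a_n$ are continuous and an element is determined by its coefficients, so elements are written as Dirichlet series $\sum_{n\ge1}a_nn^{-s}$. $\|S_N\|_{\mathcal{H}^1\to\mathcal{H}^1}$ is the operator norm. *)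

(* Defs.v *)
From HB Require Import structures.
From mathcomp Require Import all_boot all_order all_algebra.
From mathcomp Require Import complex.
From mathcomp Require Import all_classical all_reals all_analysis.

Set Implicit Arguments.
Unset Strict Implicit.
Unset Printing Implicit Defensive.

Import Order.TTheory GRing.Theory Num.Theory ComplexField.Normc.
Import numFieldNormedType.Exports.

Local Open Scope classical_set_scope.
Local Open Scope complex_scope.
Local Open Scope ring_scope.

(* n ^ s = exp (s log n), for an integer n >= 1 and a complex exponent s. *)
Definition cpown (R : realType) (n : nat) (s : R[i]) : R[i] :=
  ((n%:R : R) `^ complex.Re s)%:C *
  (cos (complex.Im s * ln (n%:R : R)) +i* sin (complex.Im s * ln (n%:R : R))).

(* A Dirichlet polynomial \sum_(1 <= n <= N) a_n n^-s is stored as the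
   polynomial with coefficients (a_1, ..., a_N): since there is no term of
   index 0, the entry p`_k is a_(k+1). *)
Definition dirpoly (R : realType) : Type := {poly R[i]}.

Definition dirpoly_eval (R : realType) (p : dirpoly R) (s : R[i]) : R[i] :=
  \sum_(k < size p) p`_k * cpown k.+1 (- s).

Definition dirpoly_norm (R : realType) (p : dirpoly R) : R :=
  lim ((fun T : R => (2 * T)^-1 *
    \int[lebesgue_measure]_(t in `[- T, T]) normc (dirpoly_eval p (0 +i* t)))
    @ +oo).

Definition dirpoly_cauchy (R : realType) (u : nat -> dirpoly R) : Prop :=
  forall e : R, 0 < e ->
    exists K : nat, forall m n : nat, (K <= m)%N -> (K <= n)%N ->
      dirpoly_norm (u m - u n) < e.

(* The completion H^1: its elements are given by Cauchy sequences of Dirichlet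
   polynomials, two sequences u, v representing the same element when
   dirpoly_norm (u k - v k) tends to 0. The norm and the coefficient functionals
   below depend only on the element represented. *)
Record H1 (R : realType) := MkH1 {
  H1_seq : nat -> dirpoly R;
  H1_seqP : dirpoly_cauchy H1_seq }.

Definition H1_norm (R : realType) (f : H1 R) : R :=
  lim ((fun k => dirpoly_norm (H1_seq f k)) @ \oo).

(* The coefficient a_n of f, for n >= 1, as the continuous extension to H^1 of
   the coefficient functional on Dirichlet polynomials. *)
Definition H1_coef (R : realType) (f : H1 R) (n : nat) : R[i] :=
  lim ((fun k => (H1_seq f k)`_n.-1 : R[i]^o) @ \oo).

Lemma dirpoly_norm0 (R : realType) : dirpoly_norm (0 : dirpoly R) = 0.
Proof.
rewrite /dirpoly_norm; apply/cvg_lim => //.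
under eq_fun => T.
  under eq_Rintegral => t _ do
    rewrite /dirpoly_eval size_poly0 big_ord0 normc0.
  rewrite Rintegral_cst// mul0r mulr0.
  over.
exact: cvg_cst.
Qed.

Lemma dirpoly_cauchy_cst (R : realType) (p : dirpoly R) :
  dirpoly_cauchy (fun=> p).
Proof.
by move=> e e0; exists 0%N => m n _ _; rewrite subrr dirpoly_norm0.
Qed.

Definition H1_of_dirpoly (R : realType) (p : dirpoly R) : H1 R :=
  MkH1 (dirpoly_cauchy_cst p).

Definition partial_sum (R : realType) (N : nat) (f : H1 R) : H1 R :=
  H1_of_dirpoly (\poly_(k < N) H1_coef f k.+1).

(* Valued in the extended reals, so that an unbounded map has norm +oo. *)
Definition H1_opnorm (R : realType) (A : H1 R -> H1 R) : \bar R :=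
  ereal_sup [set (H1_norm (A f))%:E | f in [set f : H1 R | H1_norm f <= 1]].

(* Main.v *)
Require Import Defs.
From mathcomp Require Import all_boot all_order all_algebra.
From mathcomp Require Import complex separable cyclotomic.
From mathcomp Require Import all_classical all_reals all_analysis.
From mathcomp Require Import zify ring lra.

(** Only the first N coefficients enter S_N f, and coefficients are continuous
in f, so both bounds are statements about the norm of Dirichlet polynomials.

A discrete model of the norm. Evaluate f = sum a_n n^-s at a completely
multiplicative unimodular function chi as f(chi) = sum a_n chi(n); the vertical
line is the family chi_t(n) = n^-it. The mean of a polynomial in f(chi) and its
conjugate is a sum of coefficients in front of chi(a) conj(chi(b)), and only the
diagonal terms a = b survive. As |f| is a uniform limit of such polynomials, any
family of averages under which chi(a) conj(chi(b)) has average tending to 1 if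
a = b and to 0 otherwise computes the same norm. The family used here lets
chi(n) be w ^ ilog Q n, with w ranging over the roots of unity of order
(Q + 1)^2 and ilog Q the completely additive function with
ilog Q p = floor (log_2 (p ^ Q)); see [qnorm_cvg]. For Q large, ilog Q is
strictly increasing on any prescribed initial segment of the integers. So f
becomes an ordinary polynomial in w, S_N becomes truncation of that polynomial
at the degree ilog Q N, and one-variable Fourier analysis on a finite cyclic
group applies.

The upper bound. A de la Vallee Poussin kernel replaces f by some h with
|h|_1 <= 2 |f|_1, with the same terms up to N and no term beyond N^2
([Vallee_Poussin]). If D bounds the number of divisors of the integers below
N^4, Cauchy-Schwarz on the coefficients of h^2 gives |h|_4^4 <= D |h|_2^4
([lifted_norm4_le]), hence |h|_2^2 <= D |h|_1^2. Next, truncation of polynomials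
is bounded on L^q with constant q for q = 2^k ([Riesz_projection], by Cotlar's
algebraic identity). Pairing S_N f = S_N h with a trigonometric polynomial g
such that |g| <= 1 and g S_N f is close to |S_N f|, and moving the truncation
onto g, Hoelder's inequality yields
|S_N f|_1 <= D^(1/q) |h|_1 |truncated g|_q <= 2 q D^(1/q) |f|_1.
Elementary counting gives log D = O(log N / log log N)
([size_divisors_bound]); the choice q ~ log N / log log N makes D^(1/q) bounded.

The lower bound. On series in the powers of 2 alone, S_N is the partial sum of
order n = floor (log_2 N) in one variable x. The square of sum_(a <= n) x^a,
divided by n + 1, has norm 1, because its modulus is a Fejer kernel. Its partial
sum of order n, paired with the bounded function
sum_(l <= n + 1) (x^l - conj x^l) / l, gives at least log n - 1
([dirpoly_norm_take_fejer_ge]), and log n ~ log log N. *)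

Set Implicit Arguments.
Unset Strict Implicit.
Unset Printing Implicit Defensive.

Import Order.TTheory GRing.Theory Num.Theory ComplexField.Normc.
Import numFieldNormedType.Exports.

Local Open Scope classical_set_scope.
Local Open Scope ring_scope.

(** * The modulus of complex numbers *)

Section Modulus.
Variable R : realType.
Local Notation C := R[i].
Implicit Types (x y z : C).

Lemma normc_ge0 z : 0 <= normc z.
Proof. by case: z => a b; rewrite sqrtr_ge0. Qed.

Lemma normcD_le x y : normc (x + y) <= normc x + normc y.
Proof. exact: le_normcD. Qed.

Lemma normc_opp x : normc (- x) = normc x.
Proof. exact: normcN. Qed.

Lemma normcB_le x y : normc (x - y) <= normc x + normc y.
Proof. by rewrite -(normc_opp y) normcD_le. Qed.

Lemma normcX z n : normc (z ^+ n) = normc z ^+ n.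
Proof.
elim: n => [|n IH]; first by rewrite !expr0 normc1.
by rewrite !exprS normcM IH.
Qed.

Lemma normc_real (r : R) : normc r%:C%C = `|r|.
Proof. by rewrite /normc /= expr0n addr0 sqrtr_sqr. Qed.

Lemma normc_nat n : normc (n%:R : C) = n%:R.
Proof.
have -> : (n%:R : C) = (n%:R : R)%:C%C by rewrite rmorph_nat.
by rewrite normc_real ger0_norm.
Qed.

Lemma normc_conj z : normc (z^*)%C = normc z.
Proof. by case: z => a b /=; rewrite sqrrN. Qed.

Lemma mulc_conj z : z * (z^*)%C = (normc z ^+ 2)%:C%C.
Proof.
case: z => a b /=; rewrite sqr_sqrtr ?addr_ge0 ?sqr_ge0 //.
by apply/eqP; rewrite eq_complex /=; apply/andP; split; apply/eqP; ring.
Qed.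

Lemma Re_le_normc z : complex.Re z <= normc z.
Proof.
case: z => a b /=; apply: le_trans (ler_norm a) _.
by rewrite -sqrtr_sqr ler_sqrt ?addr_ge0 ?sqr_ge0 // lerDl sqr_ge0.
Qed.

Lemma Im_le_normc z : `|complex.Im z| <= normc z.
Proof.
case: z => a b /=.
by rewrite -sqrtr_sqr ler_sqrt ?addr_ge0 ?sqr_ge0 // lerDr sqr_ge0.
Qed.

Lemma normc_sum (I : Type) (r : seq I) (P : pred I) (F : I -> C) :
  normc (\sum_(i <- r | P i) F i) <= \sum_(i <- r | P i) normc (F i).
Proof.
elim/big_rec2: _ => [|i y x _ IH]; first by rewrite normc0.
by apply: le_trans (normcD_le _ _) _; rewrite lerD2l.
Qed.

Lemma real_complex_sum (I : Type) (r : seq I) (P : pred I) (F : I -> R) :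
  (\sum_(i <- r | P i) F i)%:C%C = \sum_(i <- r | P i) (F i)%:C%C.
Proof. exact: (rmorph_sum (@real_complex R)). Qed.

End Modulus.

(** * Finite averages and their inequalities *)

Section Average.
Variables (K : fieldType) (m : nat).
Implicit Types (f g : nat -> K).

Definition avg f : K := m%:R^-1 * \sum_(j < m) f j.

Lemma eq_avg f g : (forall j, f j = g j) -> avg f = avg g.
Proof. by move=> fg; rewrite /avg; under eq_bigr do rewrite fg. Qed.

Lemma avgD f g : avg (fun j => f j + g j) = avg f + avg g.
Proof. by rewrite /avg big_split mulrDr. Qed.

Lemma avgZ c f : avg (fun j => c * f j) = c * avg f.
Proof. by rewrite /avg -mulr_sumr mulrCA. Qed.

Lemma avgN f : avg (fun j => - f j) = - avg f.
Proof. by rewrite /avg sumrN mulrN. Qed.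

Lemma avgB f g : avg (fun j => f j - g j) = avg f - avg g.
Proof. by rewrite avgD avgN. Qed.

Lemma avg_sum (I : Type) (r : seq I) (P : pred I) (F : I -> nat -> K) :
  avg (fun j => \sum_(i <- r | P i) F i j) = \sum_(i <- r | P i) avg (F i).
Proof. by rewrite /avg exchange_big mulr_sumr. Qed.

Lemma avg_exchange (F : nat -> nat -> K) :
  avg (fun i => avg (F i)) = avg (fun j => avg (F^~ j)).
Proof. by rewrite /avg -!mulr_sumr exchange_big. Qed.

End Average.

Lemma sum_CauchySchwarz (R : realDomainType) (I : Type) (r : seq I) (P : pred I)
    (f g : I -> R) :
  (\sum_(i <- r | P i) f i * g i) ^+ 2 <=
  (\sum_(i <- r | P i) f i ^+ 2) * (\sum_(i <- r | P i) g i ^+ 2).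
Proof.
have : 0 <= \sum_(i <- r | P i) \sum_(j <- r | P j) (f i * g j - f j * g i) ^+ 2.
  by apply: sumr_ge0 => i _; apply: sumr_ge0 => j _; apply: sqr_ge0.
suff -> : \sum_(i <- r | P i) \sum_(j <- r | P j) (f i * g j - f j * g i) ^+ 2 =
  2 * ((\sum_(j <- r | P j) f j ^+ 2) * (\sum_(j <- r | P j) g j ^+ 2)
      - (\sum_(j <- r | P j) f j * g j) ^+ 2) by rewrite pmulr_rge0 // subr_ge0.
have step i : \sum_(j <- r | P j) (f i * g j - f j * g i) ^+ 2 =
  f i ^+ 2 * (\sum_(j <- r | P j) g j ^+ 2)
  + g i ^+ 2 * (\sum_(j <- r | P j) f j ^+ 2)
  - f i * g i * (\sum_(j <- r | P j) f j * g j) *+ 2.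
  rewrite -mulrnAr -sumrMnl !mulr_sumr -sumrN -!big_split /=.
  by apply: eq_bigr => j _; ring.
under eq_bigr do rewrite step.
rewrite big_split /= sumrN big_split /= sumrMnl -!mulr_suml expr2; ring.
Qed.

Section RealAverage.
Variables (R : realType) (m : nat).
Hypothesis m_gt0 : (0 < m)%N.
Implicit Types (f g : nat -> R).
Local Notation E := (avg m).

Lemma avg_cst (c : R) : E (fun=> c) = c.
Proof.
rewrite /avg sumr_const card_ord -[c *+ m]mulr_natl mulrA mulVf ?mul1r //.
by rewrite pnatr_eq0 -lt0n.
Qed.

Lemma avg_ge0 f : (forall j, 0 <= f j) -> 0 <= E f.
Proof. by move=> f0; rewrite mulr_ge0 ?invr_ge0 ?sumr_ge0. Qed.

Lemma ler_avg f g : (forall j, f j <= g j) -> E f <= E g.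
Proof. by move=> fg; rewrite ler_wpM2l ?invr_ge0 ?ler_sum. Qed.

Lemma normc_avg (f : nat -> R[i]) : normc (avg m f) <= E (fun j => normc (f j)).
Proof.
rewrite /avg normcM normcV normc_nat ler_wpM2l ?invr_ge0 //; exact: normc_sum.
Qed.

Lemma avg_real (f : nat -> R) : avg m (fun j => (f j)%:C%C) = (avg m f)%:C%C.
Proof. by rewrite /avg -real_complex_sum rmorphM fmorphV rmorph_nat. Qed.

Lemma avg_CauchySchwarz f g :
  E (fun j => f j * g j) ^+ 2 <= E (fun j => f j ^+ 2) * E (fun j => g j ^+ 2).
Proof.
rewrite /avg exprMn [leRHS]mulrACA -[m%:R^-1 * _]expr2 ler_wpM2l ?sqr_ge0 //.
exact: sum_CauchySchwarz.
Qed.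

(** Cauchy-Schwarz for the weight f gives the case of squares; iterating it
gives the dyadic powers. *)
Lemma avg_Jensen k f g : (forall j, 0 <= f j) -> (forall j, 0 <= g j) ->
  E (fun j => f j * g j) ^+ (2 ^ k) <=
    E f ^+ (2 ^ k).-1 * E (fun j => f j * g j ^+ (2 ^ k)).
Proof.
move=> f0 g0; elim: k => [|k IH].
  by rewrite expn0 expr0 mul1r expr1; apply: ler_avg => j; rewrite expr1.
have fgn n : 0 <= E (fun j => f j * g j ^+ n).
  by apply: avg_ge0 => j; rewrite mulr_ge0 ?exprn_ge0.
have Ef0 := avg_ge0 f0.
have fg0 : 0 <= E (fun j => f j * g j) by apply: avg_ge0 => j; rewrite mulr_ge0.
rewrite expnS mulnC exprM.
apply: le_trans (_ : (E f ^+ (2 ^ k).-1 *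
  E (fun j => f j * g j ^+ (2 ^ k))) ^+ 2 <= _).
  rewrite ler_sqr // nnegrE; first exact: exprn_ge0.
  by apply: mulr_ge0 => //; apply: exprn_ge0.
have -> : (2 ^ k * 2).-1 = ((2 ^ k).-1 * 2 + 1)%N.
  by have := expn_gt0 2 k; lia.
rewrite addn1 [E f ^+ _.+1]exprSr exprMn -exprM -[leRHS]mulrA ler_wpM2l //;
  first exact: exprn_ge0.
have := avg_CauchySchwarz (fun j => Num.sqrt (f j))
          (fun j => Num.sqrt (f j) * g j ^+ (2 ^ k)).
rewrite (_ : E (fun j => Num.sqrt (f j) ^+ 2) = E f); last first.
  by apply: eq_avg => j; rewrite sqr_sqrtr.
rewrite (_ : E (fun j => _ * (_ * _)) = E (fun j => f j * g j ^+ (2 ^ k)));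
  last first.
  by apply: eq_avg => j; rewrite mulrA -expr2 sqr_sqrtr.
rewrite (_ : E (fun j => (_ * _) ^+ 2) = E (fun j => f j * g j ^+ (2 ^ k * 2))) //.
by apply: eq_avg => j; rewrite exprMn sqr_sqrtr // exprM.
Qed.

Lemma exp2n_convex k (a b u v : R) : 0 <= a -> 0 <= b -> a + b = 1 ->
  0 <= u -> 0 <= v ->
  (a * u + b * v) ^+ (2 ^ k) <= a * u ^+ (2 ^ k) + b * v ^+ (2 ^ k).
Proof.
move=> a0 b0 ab u0 v0; elim: k => [|k IH]; first by rewrite !expr1.
rewrite expnS mulnC !exprM.
apply: le_trans (_ : (a * u ^+ (2 ^ k) + b * v ^+ (2 ^ k)) ^+ 2 <= _).
  rewrite ler_sqr // nnegrE; last by rewrite addr_ge0 // mulr_ge0 // exprn_ge0.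
  by rewrite exprn_ge0 // addr_ge0 // mulr_ge0.
move: (u ^+ _) (v ^+ _) => U V; have -> : b = 1 - a by lra.
have : 0 <= a * (1 - a) * (U - V) ^+ 2 by rewrite mulr_ge0 ?sqr_ge0 // mulr_ge0
  //; lra.
nra.
Qed.

(** Convexity of the power, applied to the convex combination of f / a and
g / b with weights proportional to a and b. *)
Lemma avg_Minkowski k f g (a b : R) : (forall j, 0 <= f j) ->
  (forall j, 0 <= g j) -> 0 < a -> 0 < b ->
  E (fun j => f j ^+ (2 ^ k)) <= a ^+ (2 ^ k) ->
  E (fun j => g j ^+ (2 ^ k)) <= b ^+ (2 ^ k) ->
  E (fun j => (f j + g j) ^+ (2 ^ k)) <= (a + b) ^+ (2 ^ k).
Proof.
move=> f0 g0 a0 b0 fa gb; have ab0 : 0 < a + b by rewrite addr_gt0.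
pose s := a / (a + b); pose t := b / (a + b).
have st : s + t = 1 by rewrite /s /t; field; lra.
have s0 : 0 <= s by rewrite divr_ge0 ?ltW.
have t0 : 0 <= t by rewrite divr_ge0 ?ltW.
apply: le_trans (_ : E (fun j => (a + b) ^+ (2 ^ k) *
   (s * (f j / a) ^+ (2 ^ k) + t * (g j / b) ^+ (2 ^ k))) <= _).
  apply: ler_avg => j.
  rewrite (_ : f j + g j = (a + b) * (s * (f j / a) + t * (g j / b))); last first.
    by rewrite /s /t; field; apply/and3P; split; lra.
  rewrite exprMn ler_wpM2l //; first by rewrite exprn_ge0 // ltW.
  by apply: exp2n_convex; rewrite // divr_ge0 // ltW.
rewrite avgZ avgD !avgZ -[leRHS]mulr1 ler_wpM2l //.
  by rewrite exprn_ge0 // ltW.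
rewrite -st.
have aux c h : 0 < c -> E (fun j => h j ^+ (2 ^ k)) <= c ^+ (2 ^ k) ->
    E (fun j => (h j / c) ^+ (2 ^ k)) <= 1.
  move=> c0 hc; rewrite (_ : E _ = (c ^+ (2 ^ k))^-1 * E (fun j => h j ^+ (2 ^ k))).
    by rewrite ler_pdivrMl ?exprn_gt0 // mulr1.
  by rewrite -avgZ; apply: eq_avg => j; rewrite exprMn exprVn mulrC.
rewrite -[leRHS]mulr1 mulrDl; apply: lerD; rewrite ler_wpM2l //; exact: aux.
Qed.

(** With q = 2 ^ k.+1, this is Hoelder's inequality for the factorization of
f g as f^(1 - 2/q) f^(2/q) g, in the spaces L^(q/(q-2)), L^q and L^q. The L^2
norm of f that comes out is traded for the L^1 norm, at the price D. *)
Lemma avg_Hoelder k (f g : nat -> R) (D : R) :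
  (forall j, 0 <= f j) -> (forall j, 0 <= g j) -> 0 <= D ->
  E (fun j => f j ^+ 2) <= D * E f ^+ 2 ->
  E (fun j => f j * g j) ^+ (2 ^ k.+1) <=
    D * E f ^+ (2 ^ k.+1) * E (fun j => g j ^+ (2 ^ k.+1)).
Proof.
move=> f0 g0 D0 fD; have Ef0 := avg_ge0 f0.
have Eg0 : 0 <= E (fun j => g j ^+ (2 ^ k.+1)).
  by apply: avg_ge0 => // j; apply: exprn_ge0.
have Efg0 : 0 <= E (fun j => f j * g j) by apply: avg_ge0 => // j; apply: mulr_ge0.
have Efgn0 : 0 <= E (fun j => f j * g j ^+ (2 ^ k)).
  by apply: avg_ge0 => // j; rewrite mulr_ge0 ?exprn_ge0.
rewrite {1}expnSr exprM; apply: le_trans (_ : (E f ^+ (2 ^ k).-1 *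
   E (fun j => f j * g j ^+ (2 ^ k))) ^+ 2 <= _).
  rewrite ler_sqr ?nnegrE; last by rewrite mulr_ge0 // exprn_ge0.
    exact: avg_Jensen.
  exact: exprn_ge0.
rewrite exprMn; apply: le_trans (_ : (E f ^+ (2 ^ k).-1) ^+ 2 *
   ((D * E f ^+ 2) * E (fun j => g j ^+ (2 ^ k.+1))) <= _).
  rewrite ler_wpM2l //; first exact: sqr_ge0.
  apply: le_trans (avg_CauchySchwarz _ _) _.
  rewrite (_ : E (fun j => (g j ^+ _) ^+ 2) = E (fun j => g j ^+ (2 ^ k.+1))).
    exact: ler_wpM2r.
  by apply: eq_avg => j; rewrite -exprM -expnSr.
have eq2k : (2 ^ k.+1 = (2 ^ k).-1 * 2 + 2)%N.
  by rewrite expnSr; have := expn_gt0 2 k; lia.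
rewrite [E f ^+ (2 ^ k.+1)](_ : _ = (E f ^+ (2 ^ k).-1) ^+ 2 * E f ^+ 2).
  by rewrite le_eqVlt; apply/orP; left; apply/eqP; ring.
by rewrite eq2k exprD exprM.
Qed.

(** The L^2 norm lies between the L^1 and the L^4 norms: if y is the mean of f^2,
Hoelder gives y^3 <= (mean of f)^2 (mean of f^4), and the hypothesis bounds the
last factor by D y^2. *)
Lemma norm2_le_norm1 (f : nat -> R) (D : R) : (forall j, 0 <= f j) -> 0 <= D ->
  E (fun j => f j ^+ 4) <= D * E (fun j => f j ^+ 2) ^+ 2 ->
  E (fun j => f j ^+ 2) <= D * E f ^+ 2.
Proof.
move=> f0 D0 h4.
have J n : 0 <= E (fun j => f j ^+ n) by apply: avg_ge0 => // j; apply: exprn_ge0.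
have h2 : E (fun j => f j ^+ 2) ^+ 2 <= E f * E (fun j => f j ^+ 3).
  exact: (avg_Jensen 1 f0 f0).
have h3 : E (fun j => f j ^+ 3) ^+ 2 <= E (fun j => f j ^+ 2) * E (fun j => f j ^+ 4).
  rewrite (_ : E (fun j => f j ^+ 3) = E (fun j => f j ^+ 2 * f j)).
    rewrite (_ : E (fun j => f j ^+ 4) = E (fun j => f j ^+ 2 * f j ^+ 2)).
      exact: (avg_Jensen 1 (fun j => exprn_ge0 2 (f0 j)) f0).
    by apply: eq_avg => j; rewrite -exprD.
  by apply: eq_avg => j; rewrite -exprSr.
have := J 2; have := J 3; have := avg_ge0 f0.
move: (E (fun j => f j ^+ 2)) (E (fun j => f j ^+ 3)) (E (fun j => f j ^+ 4)) (E f)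
  h2 h3 h4 => y u w x h2 h3 h4 x0 u0 y0.
have [->|yn0] := eqVneq y 0; first by rewrite mulr_ge0 ?sqr_ge0.
have yp : 0 < y by rewrite lt0r yn0.
have : (y ^+ 2) ^+ 2 <= (x * u) ^+ 2 by rewrite ler_sqr ?nnegrE ?sqr_ge0 ?mulr_ge0.
rewrite [leRHS]exprMn => h5.
have h6 : x ^+ 2 * u ^+ 2 <= x ^+ 2 * (y * (D * y ^+ 2)).
  rewrite ler_wpM2l ?sqr_ge0 //; apply: le_trans h3 _; exact: ler_wpM2l.
have y3 : 0 < y ^+ 3 by apply: exprn_gt0.
rewrite -(ler_pM2l y3); apply: le_trans (_ : (y ^+ 2) ^+ 2 <= _).
  by rewrite le_eqVlt; apply/orP; left; apply/eqP; ring.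
apply: le_trans (le_trans h5 h6) _.
by rewrite le_eqVlt; apply/orP; left; apply/eqP; ring.
Qed.

End RealAverage.

(** * Fourier analysis on the group of roots of unity *)

Section RootsOfUnity.
Variables (R : realType).
Local Notation C := R[i].

Lemma prim_root_exists m : (0 < m)%N -> exists z : C, m.-primitive_root z.
Proof.
move=> m_gt0; pose p : {poly C} := 'X^m - 1.
have [r Dp] := closed_field_poly_normal p.
rewrite (monicP _) ?monicXnsubC // scale1r in Dp.
have rn1 : all m.-unity_root r by apply/allP => z; rewrite -root_prod_XsubC -Dp.
have sz_r : (m < (size r).+1)%N.
  by rewrite -(size_prod_XsubC r id) -Dp size_XnsubC.
have [|z] := hasP (cyclic.has_prim_root m_gt0 rn1 _ sz_r); last by exists z.
by rewrite -separable_prod_XsubC -Dp separable_Xn_sub_1 // pnatr_eq0 -lt0n.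
Qed.

Variables (m : nat) (z : C).
Hypothesis m_gt0 : (0 < m)%N.
Hypothesis z_prim : m.-primitive_root z.

Lemma normc_root j : normc (z ^+ j) = 1.
Proof.
rewrite normcX; suff -> : normc z = 1 by rewrite expr1n.
apply/eqP; rewrite -(@pexpr_eq1 _ _ m) ?normc_ge0 -?lt0n //.
by rewrite -normcX (prim_expr_order z_prim) normc1.
Qed.

Lemma rootX_conj j n : (n <= m)%N -> ((z ^+ j ^+ n)^*)%C = z ^+ j ^+ (m - n).
Proof.
move=> nm; have w0 : z ^+ j ^+ n != 0.
  apply/eqP => w0; have := normc_root (j * n).
  by rewrite exprM w0 normc0 => /esym/eqP; rewrite oner_eq0.
apply: (mulfI w0); rewrite mulc_conj -!exprM normc_root expr1n -exprD -mulnDr.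
by rewrite subnKC // mulnC exprM (prim_expr_order z_prim) expr1n.
Qed.

Lemma avg_root l : avg m (fun j => z ^+ j ^+ l) = (m %| l)%:R.
Proof.
have -> : avg m (fun j => z ^+ j ^+ l) = m%:R^-1 * \sum_(j < m) (z ^+ l) ^+ j.
  by congr (_ * _); apply: eq_bigr => j _; rewrite -!exprM mulnC.
have [ml|ml] := boolP (m %| l)%N.
  have -> : z ^+ l = 1.
    by have [k ->] := dvdnP ml; rewrite mulnC exprM (prim_expr_order z_prim) expr1n.
  under eq_bigr do rewrite expr1n.
  by rewrite sumr_const card_ord mulVf // pnatr_eq0 -lt0n.
have zl : z ^+ l - 1 != 0.
  apply: contra ml; rewrite subr_eq0 -[1]/(z ^+ 0) (eq_prim_root_expr z_prim).
  by rewrite mod0n.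
suff -> : \sum_(j < m) (z ^+ l) ^+ j = 0 by rewrite mulr0.
apply: (mulfI zl); rewrite -subrX1 mulr0 -exprM mulnC exprM.
by rewrite (prim_expr_order z_prim) expr1n subrr.
Qed.

Lemma avg_orth a b : (a < m)%N -> (b < m)%N ->
  avg m (fun j => z ^+ j ^+ a * ((z ^+ j ^+ b)^*)%C) = (a == b)%:R.
Proof.
move=> am bm; rewrite (_ : avg _ _ = avg m (fun j => z ^+ j ^+ (a + (m - b)))).
  rewrite avg_root; congr ((nat_of_bool _)%:R).
  apply/idP/eqP => [/dvdnP [[|[|k]]]|->]; last by rewrite subnKC ?dvdnn // ltnW.
  - by rewrite mul0n; lia.
  - by rewrite mul1n; lia.
  - by rewrite !mulSn; lia.
by apply: eq_avg => j; rewrite rootX_conj ?exprD // ltnW.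
Qed.

Lemma Parseval (I : eqType) (r : seq I) (e : I -> C) (lam : I -> nat) :
  uniq r -> {in r &, injective lam} -> {in r, forall i, (lam i < m)%N} ->
  avg m (fun j => normc (\sum_(i <- r) e i * z ^+ j ^+ lam i) ^+ 2) =
  \sum_(i <- r) normc (e i) ^+ 2.
Proof.
move=> ur inj lt; apply: (fmorph_inj (@real_complex R)) => /=.
rewrite -avg_real real_complex_sum.
rewrite (_ : avg _ _ = avg m (fun j => \sum_(i <- r) \sum_(k <- r)
   (e i * (e k)^*%C) * (z ^+ j ^+ lam i * ((z ^+ j ^+ lam k)^*)%C))); last first.
  apply: eq_avg => j; rewrite -mulc_conj (rmorph_sum (@conjc R)) mulr_suml.
  apply: eq_bigr => i _; rewrite mulr_sumr; apply: eq_bigr => k _.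
  by rewrite (rmorphM (@conjc R)) mulrACA.
rewrite avg_sum [LHS]big_seq [RHS]big_seq; apply: eq_bigr => i ir.
rewrite avg_sum (bigD1_seq i) //= avgZ avg_orth ?lt // eqxx mulr1 mulc_conj.
rewrite big_seq_cond big1 ?addr0 // => k /andP[kr ki].
rewrite avgZ avg_orth ?lt // (_ : _ == _ = false) ?mulr0 //.
by apply/negbTE; apply: contra ki => /eqP /inj ->.
Qed.

Lemma Parseval_poly (G : {poly C}) : (size G <= m)%N ->
  avg m (fun j => normc G.[z ^+ j] ^+ 2) = \sum_(i < m) normc G`_i ^+ 2.
Proof.
move=> sG.
rewrite -(@Parseval _ (index_enum 'I_m) (fun i => G`_i) (@nat_of_ord m)).
- by apply: eq_avg => j; rewrite (horner_coef_wide _ sG).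
- exact: index_enum_uniq.
- by move=> i k _ _; apply: val_inj.
- by move=> i _; apply: ltn_ord.
Qed.

Lemma avg_coef (G : {poly C}) D : (size G <= m)%N -> (D < m)%N ->
  avg m (fun j => G.[z ^+ j] * ((z ^+ j ^+ D)^*)%C) = G`_D.
Proof.
move=> sG Dm.
rewrite (_ : avg _ _ = avg m (fun j => \sum_(i < m) G`_i *
   (z ^+ j ^+ i * ((z ^+ j ^+ D)^*)%C))); last first.
  apply: eq_avg => j; rewrite (horner_coef_wide _ sG) mulr_suml.
  by apply: eq_bigr => i _; rewrite mulrA.
rewrite avg_sum (bigD1 (Ordinal Dm)) //= avgZ avg_orth // eqxx mulr1.
rewrite big1 ?addr0 // => i iD; rewrite avgZ avg_orth //.
by rewrite (_ : _ == D = false) ?mulr0 //; apply/negbTE.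
Qed.

(** Translation invariance on the group of roots of unity. *)
Lemma avg_shift (f : C -> R) j0 :
  avg m (fun j => f (z ^+ j * z ^+ j0)) = avg m (fun j => f (z ^+ j)).
Proof.
rewrite /avg; congr (_ * _).
pose s (j : 'I_m) : 'I_m := Ordinal (ltn_pmod (j + j0) m_gt0).
have s_inj : injective s.
  move=> [i im] [k km] /(congr1 val) /= /eqP; rewrite eqn_modDr.
  by rewrite !modn_small // => /eqP ik; apply: val_inj.
rewrite [RHS](reindex_inj s_inj); apply: eq_bigr => j _ /=.
by rewrite (prim_expr_mod z_prim) exprD.
Qed.

End RootsOfUnity.

(** * Truncation of polynomials in L^q *)

Section RieszProjection.
Variables (R : realType).
Local Notation C := R[i].

Definition poly_tail (K : nzRingType) s (G : {poly K}) : {poly K} :=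
  G - take_poly s G.

Lemma coef_poly_tail (K : nzRingType) s (G : {poly K}) i :
  (poly_tail s G)`_i = if (i < s)%N then 0 else G`_i.
Proof. by rewrite coefB coef_take_poly; case: ifP; rewrite ?subrr ?subr0. Qed.

Lemma size_poly_tail (K : nzRingType) s (G : {poly K}) :
  (size (poly_tail s G) <= size G)%N.
Proof.
apply/leq_sizeP => i iG; rewrite coef_poly_tail nth_default //; exact: if_same.
Qed.

(** Cotlar's identity. Let a be the tail of G and b = G - a. Then
(a - b) (a + b) = a^2 - b^2, where a^2 only has degrees >= 2 s and b^2 only has
degrees < 2 s. *)
Lemma poly_tail_sqr (K : comNzRingType) s (G : {poly K}) :
  poly_tail s G ^+ 2 = poly_tail (2 * s) ((poly_tail s G *+ 2 - G) * G).
Proof.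
set a := poly_tail s G; set b := take_poly s G.
have Gab : G = a + b by rewrite /a /poly_tail subrK.
have -> : (a *+ 2 - G) * G = a ^+ 2 - b ^+ 2 by rewrite Gab; ring.
have a0 i : (i < 2 * s)%N -> (a ^+ 2)`_i = 0.
  move=> i2s; rewrite expr2 coefM big1 // => -[j /= ji] _.
  rewrite !coef_poly_tail; case: ltnP => sj; first by rewrite mul0r.
  by case: ltnP => sij; [rewrite mulr0|lia].
have b0 i : (2 * s <= i)%N -> (b ^+ 2)`_i = 0.
  move=> si; rewrite expr2 coefM big1 // => -[j /= ji] _.
  rewrite !coef_take_poly; case: ltnP => sj; last by rewrite mul0r.
  by case: ltnP => sij; [lia|rewrite mulr0].
apply/polyP => i; rewrite coef_poly_tail coefB.
by case: ltnP => si; [rewrite a0|rewrite b0 ?subr0].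
Qed.

Lemma rootn_exists n (y : R) : (0 < n)%N -> 0 <= y ->
  exists2 x, 0 <= x & x ^+ n = y.
Proof.
move=> n0 y0; exists (y `^ n%:R^-1); first exact: powR_ge0.
by rewrite -powR_mulrn ?powR_ge0 // -powRrM mulVf ?powRr1 // pnatr_eq0 -lt0n.
Qed.

Variables (m : nat) (z : C).
Hypothesis m_gt0 : (0 < m)%N.
Hypothesis z_prim : m.-primitive_root z.

Let E := @avg R m.

(** The passage from the exponent q to 2 q. With x and y the L^2q norms of a
and g, the hypothesis becomes x^2 <= A (2 x + y) y, which forces
x <= (2 A + 1) y. *)
Lemma Riesz_step k (a g : nat -> R) (A : R) :
  (forall j, 0 <= a j) -> (forall j, 0 <= g j) -> 0 <= A ->
  E (fun j => a j ^+ (2 ^ k.+2)) <= A ^+ (2 ^ k.+1) *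
     E (fun j => (a j *+ 2 + g j) ^+ (2 ^ k.+1) * g j ^+ (2 ^ k.+1)) ->
  E (fun j => a j ^+ (2 ^ k.+2)) <=
     (A *+ 2 + 1) ^+ (2 ^ k.+2) * E (fun j => g j ^+ (2 ^ k.+2)).
Proof.
move=> a0 g0 A0 H.
set q := (2 ^ k.+1)%N in H; have rE : (2 ^ k.+2 = q * 2)%N by rewrite /q expnS mulnC.
set r := (2 ^ k.+2)%N in H rE *.
have r0 : (0 < r)%N by rewrite expn_gt0.
have Ey0 : 0 <= E (fun j => a j ^+ r) by apply: avg_ge0 => j; apply: exprn_ge0.
have Eg0 : 0 <= E (fun j => g j ^+ r) by apply: avg_ge0 => j; apply: exprn_ge0.
have [x x0 xE] := rootn_exists r0 Ey0.
have [y y0 yE] := rootn_exists r0 Eg0.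
rewrite -xE -yE -exprMn.
apply: lerXn2r; rewrite ?nnegrE ?mulr_ge0 ?addr_ge0 ?mulrn_wge0 //.
have {}H : (x ^+ r) ^+ 2 <= A ^+ r *
    (E (fun j => (a j *+ 2 + g j) ^+ r) * y ^+ r).
  rewrite xE; apply: le_trans (_ : (A ^+ q * E (fun j =>
     (a j *+ 2 + g j) ^+ q * g j ^+ q)) ^+ 2 <= _).
    rewrite ler_sqr // nnegrE mulr_ge0 ?exprn_ge0 //; apply: avg_ge0 => j.
    by rewrite mulr_ge0 ?exprn_ge0 ?addr_ge0 ?mulrn_wge0.
  rewrite exprMn -exprM -rE ler_wpM2l ?exprn_ge0 // yE.
  apply: le_trans (avg_CauchySchwarz _ _ _) _.
  rewrite (_ : avg m _ = E (fun j => (a j *+ 2 + g j) ^+ r)); last first.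
    by apply: eq_avg => j; rewrite -exprM -rE.
  rewrite (_ : avg m (fun j => (g j ^+ q) ^+ 2) = E (fun j => g j ^+ r)) //.
  by apply: eq_avg => j; rewrite -exprM -rE.
have [->|xn0] := eqVneq x 0; first by rewrite mulr_ge0 ?addr_ge0 ?mulrn_wge0.
have xp : 0 < x by rewrite lt0r xn0.
have [yz|yn0] := eqVneq y 0.
  move: H; rewrite yz expr0n gtn_eqF // !mulr0 => H.
  have /le_lt_trans/(_ _) := H; move=> /(_ _ (exprn_gt0 2 (exprn_gt0 r xp))).
  by rewrite ltxx.
have yp : 0 < y by rewrite lt0r yn0.
have M : E (fun j => (a j *+ 2 + g j) ^+ r) <= (x *+ 2 + y) ^+ r.
  apply: avg_Minkowski => //.
  - by move=> j; rewrite mulrn_wge0.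
  - by rewrite pmulrn_lgt0.
  - rewrite -[x *+ 2]mulr_natl exprMn -/r xE -avgZ; apply: ler_avg => j.
    by rewrite -[a j *+ 2]mulr_natl exprMn.
  - by rewrite -/r yE.
have {}H : (x ^+ 2) ^+ r <= (A * ((x *+ 2 + y) * y)) ^+ r.
  rewrite -exprM mulnC exprM !exprMn; apply: le_trans H _.
  by rewrite ler_wpM2l ?exprn_ge0 // ler_wpM2r ?exprn_ge0.
have {}H : x ^+ 2 <= A * ((x *+ 2 + y) * y).
  move: H; rewrite ler_pXn2r // nnegrE ?exprn_ge0 ?mulr_ge0 //.
  by rewrite addr_ge0 // mulrn_wge0.
rewrite leNgt; apply/negP => lt.
have h1 : 0 < x * (x - (A *+ 2 + 1) * y) by rewrite mulr_gt0 // subr_gt0.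
have h2 : 0 < y * (x - (A *+ 2 + 1) * y) by rewrite mulr_gt0 // subr_gt0.
have h3 : 0 <= A * (y * y) by rewrite !mulr_ge0.
have h4 : 0 < y * y by rewrite mulr_gt0.
move: H; rewrite expr2 !mulr2n in h1 h2 *; nra.
Qed.

(** M. Riesz's theorem at q = 2 ^ k.+1, by induction on k through Cotlar's
identity, starting from Parseval. The point is that the constant grows only
linearly in q. The size condition keeps the polynomials that the induction
produces from wrapping around modulo m. *)
Theorem Riesz_projection k (G : {poly C}) s : (size G * 2 ^ k <= m)%N ->
  E (fun j => normc (poly_tail s G).[z ^+ j] ^+ (2 ^ k.+1)) <=
  ((2 ^ k.+1).-1%:R) ^+ (2 ^ k.+1) * E (fun j => normc G.[z ^+ j] ^+ (2 ^ k.+1)).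
Proof.
elim: k G s => [|k IH] G s.
  rewrite muln1 => Gm; rewrite expn1 /= expr1n mul1r /E.
  rewrite !(Parseval_poly m_gt0 z_prim) ?(leq_trans (size_poly_tail _ _)) //.
  apply: ler_sum => i _; rewrite coef_poly_tail; case: ifP => // _.
  by rewrite normc0 expr0n sqr_ge0.
move=> Gm; set a := poly_tail s G.
have -> : (2 ^ k.+2).-1%:R = (2 ^ k.+1).-1%:R *+ 2 + 1 :> R.
  rewrite -mulrnA natr1; congr (_%:R).
  by have := expn_gt0 2 k.+1; rewrite (expnS 2 k.+1); lia.
apply: Riesz_step => //; try by move=> j; apply: normc_ge0.
pose H := (a *+ 2 - G) * G.
have sH : (size H * 2 ^ k <= m)%N.
  apply: leq_trans Gm; rewrite expnS mulnA leq_mul2r; apply/orP; right.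
  apply: leq_trans (size_polyMleq _ _) _.
  apply: leq_trans (leq_pred _) _; rewrite muln2 -addnn leq_add2r.
  apply/leq_sizeP => i iG; rewrite coefB coefMn !nth_default ?mul0rn ?subrr //.
  exact: leq_trans (size_poly_tail _ _) iG.
have := IH H (2 * s)%N sH; rewrite -poly_tail_sqr -/a => IHa.
rewrite (_ : E _ = E (fun j => normc (a ^+ 2).[z ^+ j] ^+ (2 ^ k.+1))); last first.
  by apply: eq_avg => j; rewrite horner_exp normcX -exprM -expnS.
apply: le_trans IHa _; rewrite ler_wpM2l ?exprn_ge0 //; apply: ler_avg => j.
rewrite hornerM normcM exprMn ler_wpM2r ?exprn_ge0 ?normc_ge0 //.
apply: lerXn2r; rewrite ?nnegrE ?normc_ge0 // ?addr_ge0 ?mulrn_wge0 ?normc_ge0 //.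
rewrite hornerD hornerN hornerMn; apply: le_trans (normcB_le _ _) _.
by rewrite lerD2r mulr2n; apply: normcD_le.
Qed.

End RieszProjection.

(** * An integer-valued logarithm *)

Section IntegerLogarithm.
Local Open Scope nat_scope.

(** About Q log_2 n, but exactly additive on products: rounding is done at
the primes. *)
Definition ilog Q n := \sum_(p < n.+1) logn p n * trunc_log 2 (p ^ Q).

Lemma ilog_wide Q n B : 0 < n -> n < B ->
  ilog Q n = \sum_(p < B) logn p n * trunc_log 2 (p ^ Q).
Proof.
move=> n0 nB; rewrite /ilog; pose F p := logn p n * trunc_log 2 (p ^ Q).
rewrite -(big_mkord xpredT F) -(big_mkord xpredT F) {}/F.
rewrite [RHS](big_cat_nat _ nB) //= [X in _ = _ + X]big1_seq ?addn0 //.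
move=> p /=; rewrite mem_index_iota => /andP[np _].
by rewrite lognE [p %| n]gtnNdvd // !andbF.

Qed.

Lemma ilogM Q a b : 0 < a -> 0 < b -> ilog Q (a * b) = ilog Q a + ilog Q b.
Proof.
move=> a0 b0; have ab0 : 0 < a * b by rewrite muln_gt0 a0.
rewrite (@ilog_wide Q a (a * b).+1) ?ltnS ?leq_pmulr //.
rewrite (@ilog_wide Q b (a * b).+1) ?ltnS ?leq_pmull // -big_split /=.
by apply: eq_bigr => p _; rewrite lognM // mulnDl.
Qed.

Lemma ilog1 Q : ilog Q 1 = 0.
Proof. by rewrite /ilog big1 // => p _; rewrite logn1. Qed.

Lemma ilog_prime Q p : prime p -> ilog Q p = trunc_log 2 (p ^ Q).
Proof.
move=> pp; rewrite /ilog (bigD1 ord_max) //= logn_prime // eqxx mul1n.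
rewrite big1 ?addn0 // => q qp; rewrite logn_prime // (_ : _ == _ = false) //.
by apply/negbTE; apply: contra qp => /eqP pq; apply/eqP/val_inj.
Qed.

Lemma ilogX Q a n : 0 < a -> ilog Q (a ^ n) = n * ilog Q a.
Proof.
move=> a0; elim: n => [|n IH]; first by rewrite expn0 ilog1.
by rewrite expnS ilogM ?expn_gt0 ?a0 // IH mulSn.
Qed.

Lemma prime_ind (P : nat -> Prop) : P 1 ->
  (forall p n, prime p -> 0 < n -> P n -> P (p * n)) -> forall n, 0 < n -> P n.
Proof.
move=> P1 PM; elim/ltn_ind => n IH n0.
have [n1|n1] := leqP n 1; first by have -> : n = 1 by lia.
have pp := pdiv_prime n1; have /dvdnP [m nE] := pdiv_dvd n.
have m0 : 0 < m by case: m nE => //; lia.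
rewrite nE mulnC; apply: PM => //; apply: IH => //.
by rewrite [ltnRHS]nE ltn_Pmulr // prime_gt1.
Qed.

Lemma ilog_bounds Q n : 0 < n -> 2 ^ ilog Q n <= n ^ Q <= 2 ^ (ilog Q n + n).
Proof.
move: n; apply: prime_ind => [|p n pp n0 /andP[IH1 IH2]].
  by rewrite ilog1 exp1n.
have p0 := prime_gt0 pp; have pQ : 0 < p ^ Q by rewrite expn_gt0 p0.
rewrite ilogM // ilog_prime // expnMn expnD.
have /andP[h1 h2] := trunc_log_bounds (isT : 1 < 2) pQ.
rewrite leq_mul //=; apply: leq_trans (leq_mul (ltnW h2) IH2) _.
rewrite -expnD leq_exp2l //; have := prime_gt1 pp; nia.
Qed.

Lemma ilog_le Q n : 0 < n -> ilog Q n <= Q * n.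
Proof.
move=> n0; have /andP[h _] := ilog_bounds Q n0.
rewrite -(leq_exp2l (m := 2)) //; apply: leq_trans h _.
rewrite mulnC expnM; case: Q => [|Q]; first by rewrite !expn0.
by rewrite leq_exp2r //; apply/ltnW/ltn_expl.
Qed.

(** The rounding error, at most b, is independent of Q, whereas
Q (log_2 b - log_2 a) grows with Q. *)
Lemma ilog_ltn a b Q : 0 < a -> a < b -> a * 2 ^ b <= Q -> ilog Q a < ilog Q b.
Proof.
move=> a0 ab hQ; rewrite ltnNge; apply/negP => le.
have b0 : 0 < b by lia.
have /andP[h1 _] := ilog_bounds Q a0; have /andP[_ h2] := ilog_bounds Q b0.
(* Bernoulli's inequality for (1 + 1 / a) ^ Q, cleared of denominators *)
have bern : a ^ Q * (a + Q) <= a * a.+1 ^ Q.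
  elim: Q {hQ le h1 h2} => [|Q IH]; first by rewrite !expn0 mul1n muln1 addn0.
  rewrite [a.+1 ^ _]expnS mulnCA; apply: leq_trans (leq_mul (leqnn a.+1) IH).
  rewrite expnS -mulnA mulnCA [leqRHS]mulnCA leq_mul2l; apply/orP; right; nia.
have h3 : b ^ Q <= a ^ Q * 2 ^ b.
  apply: leq_trans h2 _; rewrite expnD leq_mul2r; apply/orP; right.
  by apply: leq_trans h1; rewrite leq_exp2l.
have h4 : a.+1 ^ Q <= b ^ Q by case: (Q) => // q; rewrite leq_exp2r.
have aQ : 0 < a ^ Q by rewrite expn_gt0 a0.
have h5 : a ^ Q * (a + Q) <= a ^ Q * (a * 2 ^ b).
  apply: leq_trans bern _; rewrite mulnCA leq_mul2l; apply/orP; right.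
  exact: leq_trans h4 h3.
by move: h5; rewrite leq_pmul2l //; lia.
Qed.

End IntegerLogarithm.

(** * The number of divisors *)

Section DivisorBound.
Local Open Scope nat_scope.

(** A divisor of p n divides n or is p times a divisor of n. *)
Lemma size_divisors_primeM p n : prime p -> 0 < n ->
  size (divisors (p * n)) <= 2 * size (divisors n).
Proof.
move=> pp n0; have p0 := prime_gt0 pp.
rewrite mul2n -addnn -[X in _ + X](size_map (muln p)) -size_cat.
apply: uniq_leq_size; first exact: divisors_uniq.
move=> d; rewrite -dvdn_divisors ?muln_gt0 ?p0 // mem_cat => dpn.
have [cop|] := boolP (coprime d p).
  by rewrite -dvdn_divisors // -(Gauss_dvdr _ cop) dpn.
rewrite coprime_sym prime_coprime // negbK => /dvdnP[e de]; apply/orP; right.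
apply/mapP; exists e; last by rewrite de mulnC.
by rewrite -dvdn_divisors // -(dvdn_pmul2l p0) mulnC -de.
Qed.

(** A divisor is determined by its exponents at the primes below y, each at
most T. *)
Lemma size_divisors_smooth y T n : 0 < n -> n < 2 ^ T.+1 ->
  {in primes n, forall p, p < y} -> size (divisors n) <= T.+1 ^ y.
Proof.
move=> n0 nT ny.
pose f d : {ffun 'I_y -> 'I_T.+1} := [ffun p : 'I_y => inord (logn p d)].
have dn d : d \in divisors n -> 0 < d /\ d %| n.
  by rewrite -dvdn_divisors // => h; split => //; apply: dvdn_gt0 h.
have lT p d : d \in divisors n -> logn p d < T.+1.
  move=> /dn[d0 dvd]; have [pp|pp] := boolP (prime p); last first.
    by rewrite lognE (negbTE pp).
  rewrite -(ltn_exp2l (m := 2)) //; apply: leq_ltn_trans nT.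
  apply: leq_trans (dvdn_leq n0 dvd);
    apply: leq_trans (dvdn_leq d0 (pfactor_dvdnn p d)).
  case: (logn p d) => // l; rewrite leq_exp2r //; exact: prime_gt1.
have inj : {in divisors n &, injective f}.
  move=> d e dd ee fde; have [d0 ddvd] := dn _ dd; have [e0 edvd] := dn _ ee.
  apply: eqn_from_log => // p; have [py|yp] := ltnP p y.
    have := congr1 (fun g : {ffun 'I_y -> 'I_T.+1} => val (g (Ordinal py))) fde.
    by rewrite !ffunE /= !inordK ?lT.
  have pn : p \notin primes n by apply/negP => /ny; lia.
  suff h k : 0 < k -> k %| n -> logn p k = 0 by rewrite !h.
  move=> k0 kn; apply/eqP; rewrite -leqn0 leqNgt logn_gt0; apply/negP.
  by rewrite mem_primes => /and3P[pp _ /dvdn_trans/(_ kn) pn']; move: pn;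
    rewrite mem_primes pp n0 pn'.
have := max_card (mem [seq f d | d <- divisors n]).
rewrite card_ffun !card_ord; apply: leq_trans.
by rewrite (card_uniqP _) ?size_map // map_inj_in_uniq ?divisors_uniq.
Qed.

(** Remove the r prime factors >= y one by one: each at most doubles the
number of divisors, and together they multiply to at least y ^ r. What remains
is y-smooth. *)
Lemma size_divisors_split y T n : 0 < n -> n < 2 ^ T.+1 ->
  exists r, size (divisors n) <= T.+1 ^ y * 2 ^ r /\ y ^ r <= n.
Proof.
elim/ltn_ind: n => n IH n0 nT.
have [/hasP[p pn yp]|] := boolP (has (leq y) (primes n)); last first.
  move=> /hasPn ny; exists 0; rewrite muln1; split => //.
  by apply: size_divisors_smooth => // p /ny; rewrite ltnNge.
move: pn; rewrite mem_primes => /and3P[pp _ /dvdnP[k nE]].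
have k0 : 0 < k by case: k nE => //; lia.
have kn : k < n by rewrite nE ltn_Pmulr // prime_gt1.
have [r [h1 h2]] := IH k kn k0 (ltn_trans kn nT).
exists r.+1; split; last by rewrite nE expnSr leq_mul.
rewrite nE mulnC; apply: leq_trans (size_divisors_primeM pp k0) _.
by rewrite expnS mulnCA leq_mul2l h1 orbT.
Qed.

End DivisorBound.

Section DivisorBoundReal.
Variable R : realType.

Lemma ln_nat_near (K : R) : \forall N \near \oo, K <= ln (N%:R : R).
Proof.
exists (Num.truncn (expR K)).+1 => // N /= hN.
have h : expR K < N%:R.
  by apply: lt_le_trans (truncnS_gt _) _; rewrite ler_nat.
by rewrite -[K]expRK ler_ln ?posrE ?expR_gt0 ?(lt_trans (expR_gt0 K) h) // ltW.
Qed.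

Lemma ln2_bounds : 2^-1 <= ln (2 : R) <= 1.
Proof.
apply/andP; split.
  rewrite -[leLHS]expRK ler_ln ?posrE ?expR_gt0 //.
  have h : 2^-1 <= expR (- 2^-1) :> R.
    by apply: le_trans (expR_ge1Dx _); lra.
  have : expR 2^-1 * expR (- 2^-1) = 1 :> R by rewrite -expRD subrr expR0.
  have := expR_gt0 (2^-1 : R); nra.
by apply: le_trans (le_ln1Dx (_ : -1 < 1)) _; lra.
Qed.

Lemma ln_le_self (x : R) : 0 < x -> ln x <= x.
Proof.
move=> x0; have h : -1 < x - 1 by lra.
have := le_ln1Dx h; rewrite (_ : 1 + (x - 1) = x); first lra.
by ring.
Qed.

(** [size_divisors_split] with y about the square root of log N and T of the
order of log N: the smooth primes contribute y log T = O(sqrt(log N) log log N)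
to the logarithm of the number of divisors, the rough ones O(log N / log y), and
the second term dominates. *)
Lemma size_divisors_bound : exists2 c : R, 0 < c & \forall N \near \oo,
  forall k, (0 < k < N ^ 4)%N ->
  (size (divisors k))%:R <= expR (c * (ln (N%:R : R) / ln (ln (N%:R : R)))).
Proof.
exists 72 => //; near=> N.
have L9 : 9 <= ln (N%:R : R) by near: N; apply: ln_nat_near.
move=> k /andP[k0 kN]; set L := ln N%:R in L9 *.
have Lp : 0 < L by lra.
have N0 : (0 < N)%N by case: (N) kN => //; rewrite exp0n.
have lL0 : 0 < ln L by apply: ln_gt0; lra.
have lnk : ln (k%:R : R) <= 4 * L.
  have -> : 4 * L = ln ((N ^ 4)%:R : R) by rewrite natrX lnXn ?ltr0n // mulr_natl.
  by rewrite ler_ln ?posrE ?ltr0n ?expn_gt0 ?N0 // ler_nat ltnW.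
have /andP[l2a l2b] := ln2_bounds.
pose s := Num.sqrt L; have s0 : 0 < s by rewrite sqrtr_gt0.
have sL : s ^+ 2 = L by rewrite sqr_sqrtr // ltW.
(* t is the fourth root of L: ln L = 4 ln t <= 4 t makes (ln L)^2 = O(s) *)
pose t := Num.sqrt s; have t0 : 0 < t by rewrite sqrtr_gt0.
have ts : t ^+ 2 = s by rewrite sqr_sqrtr // ltW.
have s1 : 1 <= s by rewrite -sqrtr1 ler_sqrt //; lra.
have lnsL : ln L = 2 * ln s by rewrite -sL lnXn // mulr_natl.
have lnts : ln s = 2 * ln t by rewrite -ts lnXn // mulr_natl.
have lnt : ln t <= t := ln_le_self t0.
pose y := (Num.truncn s).+1.
have sy : s <= y%:R by apply/ltW/truncnS_gt.
have ys : (y%:R : R) <= 2 * s.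
  have := truncn_le s; rewrite (ltW s0) => h.
  by rewrite -[y%:R]natr1; lra.
pose T := trunc_log 2 k.
have /andP[Tk kT] := trunc_log_bounds (isT : (1 < 2)%N) k0.
have T8 : T%:R <= 8 * L.
  have : (ln (2 ^ T)%:R : R) <= ln k%:R.
    by rewrite ler_ln ?posrE ?ltr0n ?expn_gt0 // ler_nat.
  rewrite natrX lnXn // -[ln _ *+ _]mulr_natr => h.
  have : (2^-1 * T%:R : R) <= ln 2 * T%:R by rewrite ler_wpM2r.
  lra.
have [r [h1 h2]] := size_divisors_split y k0 kT.
have r8 : r%:R * ln L <= 8 * L.
  have : (ln (y ^ r)%:R : R) <= ln k%:R.
    by rewrite ler_ln ?posrE ?ltr0n ?expn_gt0 // ler_nat.
  rewrite natrX lnXn ?ltr0n // -[ln _ *+ _]mulr_natr => h.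
  have : ln s * r%:R <= ln y%:R * r%:R.
    by rewrite ler_wpM2r // ler_ln ?posrE ?ltr0n.
  by rewrite lnsL; lra.
apply: le_trans (_ : (T.+1 ^ y * 2 ^ r)%:R <= _); first by rewrite ler_nat.
have A0 : 0 < (T.+1 ^ y * 2 ^ r)%:R :> R by rewrite ltr0n muln_gt0 !expn_gt0.
rewrite -[leLHS]lnK ?posrE // ler_expR natrM lnM ?posrE ?ltr0n ?expn_gt0 //.
rewrite !natrX !lnXn ?ltr0n //.
have lnT : ln (T.+1%:R : R) <= 2 * ln L.
  have -> : 2 * ln L = ln (L * L) by rewrite lnM ?posrE // mulr_natl mulr2n.
  rewrite ler_ln ?posrE ?ltr0n ?mulr_gt0 //.
  apply: le_trans (_ : 9 * L <= _); last by rewrite ler_wpM2r // ltW.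
  rewrite -natr1; clear -T8 L9; lra.
have b1 : ln T.+1%:R *+ y <= 4 * s * ln L.
  have -> : 4 * s * ln L = (2 * s) * (2 * ln L) by ring.
  have -> : ln T.+1%:R *+ y = y%:R * ln T.+1%:R :> R by rewrite mulr_natl.
  by apply: ler_pM => //; rewrite ln_ge0 // ler1n.
have b2 : s * ln L <= 16 * (L / ln L).
  rewrite mulrA ler_pdivlMr // -mulrA -expr2.
  have : ln L ^+ 2 <= 16 * s.
    have -> : ln L = 4 * ln t by rewrite lnsL lnts; ring.
    have -> : 16 * s = (4 * t) ^+ 2 by rewrite -ts; ring.
    have lnt0 : 0 <= ln t by rewrite lnsL lnts in lL0; clear -lL0; lra.
    have t4 : 4 * ln t <= 4 * t by apply: ler_wpM2l.
    by apply: lerXn2r t4; rewrite nnegrE mulr_ge0 // ltW.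
  move=> h; apply: le_trans (_ : s * (16 * s) <= _);
    first by rewrite ler_wpM2l // ltW.
  by rewrite mulrCA -expr2 sL.
have b3 : ln 2 *+ r <= 8 * (L / ln L) :> R.
  have -> : ln 2 *+ r = r%:R * ln 2 :> R by rewrite mulr_natl.
  rewrite mulrA ler_pdivlMr //.
  by apply: le_trans r8; rewrite mulrAC ler_piMr // mulr_ge0 // ltW.
apply: le_trans (lerD b1 b3) _; rewrite -mulrA.
by move: (s * ln L) (L / ln L) b2 => u v; clear; lra.
Unshelve. all: by end_near.
Qed.

End DivisorBoundReal.

(** * Completely multiplicative characters and trigonometric polynomials *)

Section Characters.
Variable R : realType.
Local Notation C := R[i].

Definition unimodular_char (chi : nat -> C) : Prop :=
  (forall n, (0 < n)%N -> normc (chi n) = 1) /\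
  (forall a b, (0 < a)%N -> (0 < b)%N -> chi (a * b)%N = chi a * chi b).

(** An entry (c, (a, b)) stands for the term c chi(a) conj(chi(b)). *)
Definition trigval (s : seq (C * (nat * nat))) (chi : nat -> C) : C :=
  \sum_(x <- s) x.1 * (chi x.2.1 * ((chi x.2.2)^*)%C).

(** The mean of [trigval s] for every family of characters under which the
off-diagonal terms average out. *)
Definition trigmean (s : seq (C * (nat * nat))) : C :=
  \sum_(x <- s | x.2.1 == x.2.2) x.1.

Definition posfreq (s : seq (C * (nat * nat))) :=
  all (fun x => (0 < x.2.1)%N && (0 < x.2.2)%N) s.

(** Equality is only required on unimodular characters, so the class is closed
under products: chi(a) chi(a') = chi(a a'). *)
Definition trigpoly (phi : (nat -> C) -> C) : Prop :=
  exists2 s, posfreq s & forall chi, unimodular_char chi -> phi chi = trigval s chi.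

Lemma eq_trigpoly phi psi : (forall chi, unimodular_char chi -> phi chi = psi chi) ->
  trigpoly phi -> trigpoly psi.
Proof. by move=> h [s s0 hs]; exists s => // chi hchi; rewrite -h // hs. Qed.

Lemma trigpoly_monomial c a b : (0 < a)%N -> (0 < b)%N ->
  trigpoly (fun chi => c * (chi a * ((chi b)^*)%C)).
Proof.
move=> a0 b0; exists [:: (c, (a, b))]; first by rewrite /posfreq /= a0 b0.
by move=> chi _; rewrite /trigval big_seq1.
Qed.

Lemma char1 chi : unimodular_char chi -> chi 1%N = 1.
Proof.
move=> [h1 hM]; have nz : chi 1%N != 0.
  by apply/eqP => h; have := h1 1%N isT; rewrite h normc0 => /esym/eqP;
    rewrite oner_eq0.
by apply: (mulfI nz); rewrite -hM // mulr1.
Qed.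

Lemma trigpoly_cst c : trigpoly (fun=> c).
Proof.
apply: eq_trigpoly (@trigpoly_monomial c 1%N 1%N isT isT) => chi hchi.
by rewrite char1 // conjc1 !mulr1.
Qed.

Lemma trigpoly_char n : (0 < n)%N -> trigpoly (fun chi => chi n).
Proof.
move=> n0; apply: eq_trigpoly (@trigpoly_monomial 1 n 1%N n0 isT) => chi hchi.
by rewrite char1 // conjc1 mulr1 mul1r.
Qed.

Lemma trigpolyD phi psi : trigpoly phi -> trigpoly psi ->
  trigpoly (fun chi => phi chi + psi chi).
Proof.
move=> [s s0 hs] [t t0 ht]; exists (s ++ t).
  by rewrite /posfreq all_cat; apply/andP.
by move=> chi hchi; rewrite /trigval big_cat hs // ht.
Qed.

Lemma trigpolyM phi psi : trigpoly phi -> trigpoly psi ->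
  trigpoly (fun chi => phi chi * psi chi).
Proof.
move=> [s s0 hs] [t t0 ht].
exists [seq (x.1 * y.1, ((x.2.1 * y.2.1)%N, (x.2.2 * y.2.2)%N)) | x <- s, y <- t].
  apply/allP => _ /allpairsP[[x y] /= [xs yt ->]] /=.
  by have /andP[] := allP s0 _ xs; have /andP[] := allP t0 _ yt; lia.
move=> chi hchi; rewrite hs // ht // /trigval big_allpairs_dep mulr_suml.
rewrite big_seq [RHS]big_seq; apply: eq_bigr => x xs.
rewrite mulr_sumr big_seq [RHS]big_seq; apply: eq_bigr => y yt /=.
have /andP[x1 x2] := allP s0 _ xs; have /andP[y1 y2] := allP t0 _ yt.
by rewrite !(hchi.2) // (rmorphM (@conjc R)); ring.
Qed.

Lemma trigpolyZ c phi : trigpoly phi -> trigpoly (fun chi => c * phi chi).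
Proof. exact/trigpolyM/trigpoly_cst. Qed.

Lemma trigpolyB phi psi : trigpoly phi -> trigpoly psi ->
  trigpoly (fun chi => phi chi - psi chi).
Proof.
move=> h1 /(trigpolyZ (-1)) h2; apply: eq_trigpoly (trigpolyD h1 h2) => chi _.
by rewrite mulN1r.
Qed.

Lemma trigpoly_conj phi : trigpoly phi -> trigpoly (fun chi => ((phi chi)^*)%C).
Proof.
move=> [s s0 hs]; exists [seq ((x.1^*)%C, (x.2.2, x.2.1)) | x <- s].
  by rewrite /posfreq all_map; apply: sub_all s0 => x /=; rewrite andbC.
move=> chi hchi; rewrite hs // /trigval big_map (rmorph_sum (@conjc R)).
apply: eq_bigr => x _ /=; rewrite !(rmorphM (@conjc R)) /= conjcK.
by congr (_ * _); rewrite mulrC.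
Qed.

Lemma trigpoly_sum (I : eqType) (r : seq I) (F : I -> (nat -> C) -> C) :
  {in r, forall i, trigpoly (F i)} -> trigpoly (fun chi => \sum_(i <- r) F i chi).
Proof.
elim: r => [|i r IH] h.
  by apply: eq_trigpoly (trigpoly_cst 0) => chi _; rewrite big_nil.
apply: (@eq_trigpoly (fun chi => F i chi + \sum_(i <- r) F i chi)).
  by move=> chi _; rewrite big_cons.
apply: trigpolyD; first by apply: h; rewrite mem_head.
by apply: IH => j jr; apply: h; rewrite in_cons jr orbT.
Qed.

Definition dirval (p : dirpoly R) (chi : nat -> C) : C :=
  \sum_(k < size p) p`_k * chi k.+1.

Lemma trigpoly_dirval p : trigpoly (dirval p).
Proof. by apply: trigpoly_sum => k _; apply/trigpolyZ/trigpoly_char. Qed.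

Lemma dirval_wide (p : dirpoly R) chi n : (size p <= n)%N ->
  dirval p chi = \sum_(k < n) p`_k * chi k.+1.
Proof.
move=> pn; rewrite /dirval (big_ord_widen _ (fun k => p`_k * chi k.+1) pn).
rewrite big_mkcond; apply: eq_bigr => k _; case: ltnP => // h.
by rewrite nth_default // mul0r.
Qed.

Lemma dirvalD p q chi : dirval (p + q) chi = dirval p chi + dirval q chi.
Proof.
pose n := maxn (size p) (size q).
rewrite !(@dirval_wide _ _ n) ?leq_maxl ?leq_maxr ?size_polyD //.
by rewrite -big_split; apply: eq_bigr => k _; rewrite coefD mulrDl.
Qed.

Lemma dirvalN p chi : dirval (- p) chi = - dirval p chi.
Proof.
rewrite /dirval size_polyN -sumrN; apply: eq_bigr => k _.
by rewrite coefN mulNr.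
Qed.

Definition coef_norm1 (p : dirpoly R) : R := \sum_(k < size p) normc p`_k.

Lemma dirval_le p chi : unimodular_char chi -> normc (dirval p chi) <= coef_norm1 p.
Proof.
move=> hchi; apply: le_trans (normc_sum _ _ _) _; apply: ler_sum => k _.
by rewrite normcM hchi.1 // mulr1.
Qed.

(** P_j(v) = v [invsqrt_approx j v] is the classical iteration
P_0 = 0, P_(j+1) = P_j + (v - P_j^2) / 2 for the square root, divided by v so
that both |z| and conj(z) / |z| become limits of polynomials. *)
Fixpoint invsqrt_approx j (v : R) : R :=
  if j is j'.+1 then
    invsqrt_approx j' v + (1 - v * invsqrt_approx j' v ^+ 2) / 2
  else 0.

(** The error e_j = u - P_j(u^2) satisfies e_(j+1) <= e_j (1 - e_j / 2), whence
the rate 2 / (j + 2); it is uniform down to u = 0. *)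
Lemma invsqrt_approxP j (u : R) : 0 <= u <= 1 ->
  [/\ 0 <= invsqrt_approx j (u ^+ 2), u * invsqrt_approx j (u ^+ 2) <= 1 &
      0 <= u - u ^+ 2 * invsqrt_approx j (u ^+ 2) <= 2 / j.+2%:R].
Proof.
move=> /andP[u0 u1].
suff : [/\ 0 <= invsqrt_approx j (u ^+ 2), u * invsqrt_approx j (u ^+ 2) <= 1 &
    (u - u ^+ 2 * invsqrt_approx j (u ^+ 2)) * j.+2%:R <= 2].
  move=> [h1 h2 h3]; split => //; rewrite ler_pdivlMr ?ltr0n // h3 andbT.
  by rewrite subr_ge0 expr2 -mulrA ler_piMr.
elim: j => [|j [h1 h2 h3]] /=.
  by split; rewrite ?mulr0 // subr0; lra.
set r := invsqrt_approx j _ in h1 h2 h3 *.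
have ur0 : 0 <= u * r by rewrite mulr_ge0.
have e0 : 0 <= u - u ^+ 2 * r.
  by rewrite subr_ge0 expr2 -mulrA ler_piMr.
have eu : u - u ^+ 2 * r <= u by rewrite gerBl mulr_ge0 ?sqr_ge0.
have ur1 : u ^+ 2 * r ^+ 2 <= 1 by rewrite -exprMn expr_le1.
split.
- by rewrite addr_ge0 // divr_ge0 // subr_ge0.
- move: h2 ur0; rewrite -[u ^+ 2 * _]exprMn mulrDr; move: (u * r) => rho h2 ur0.
  have : u * ((1 - rho ^+ 2) / 2) <= (1 - rho ^+ 2) / 2.
    by rewrite ler_piMl // divr_ge0 // subr_ge0 expr_le1.
  nra.
- set e := u - u ^+ 2 * r in h3 e0 eu *.
  have -> : u - u ^+ 2 * (r + (1 - u ^+ 2 * r ^+ 2) / 2) = e * (1 - u + e / 2).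
    by rewrite /e; field.
  have e1 : e <= 1 by lra.
  rewrite -[j.+3%:R]natr1.
  have h4 : e * (1 - u + e / 2) <= e * (1 - e / 2).
    by rewrite ler_wpM2l //; lra.
  have J0 : 0 <= j.+2%:R :> R by [].
  apply: le_trans (_ : e * (1 - e / 2) * (j.+2%:R + 1) <= _).
    by rewrite ler_wpM2r // addr_ge0.
  have : e * j.+2%:R * (1 - e / 2) <= 2 * (1 - e / 2).
    by rewrite ler_wpM2r //; lra.
  have := sqr_ge0 e; rewrite expr2; move: (j.+2%:R) => J; nra.
Qed.

Lemma trigpoly_invsqrt j (v : (nat -> C) -> R) :
  trigpoly (fun chi => (v chi)%:C%C) ->
  trigpoly (fun chi => (invsqrt_approx j (v chi))%:C%C).
Proof.
move=> hv; elim: j => [|j IH] /=; first exact: trigpoly_cst.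
apply: eq_trigpoly (trigpolyD IH (trigpolyZ (2^-1)%:C%C (trigpolyB
  (trigpoly_cst 1) (trigpolyM hv (trigpolyM IH IH))))) => chi _.
rewrite -!rmorphM -(rmorph1 (@real_complex R)) -rmorphB -rmorphM -rmorphD.
by rewrite -expr2 [_ / 2]mulrC.
Qed.

Lemma trigpoly_sqr_normc phi : trigpoly phi ->
  trigpoly (fun chi => (normc (phi chi) ^+ 2)%:C%C).
Proof.
move=> h; apply: eq_trigpoly (trigpolyM h (trigpoly_conj h)) => chi _.
exact: mulc_conj.
Qed.

(** The order of the group of roots of unity: quadratic in Q, hence eventually
larger than any constant multiple of ilog Q n. *)
Definition qsize Q := (Q.+1 ^ 2)%N.

Lemma qsize_gt0 Q : (0 < qsize Q)%N. Proof. by rewrite expn_gt0. Qed.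

Definition qroot Q : C := projT1 (cid (@prim_root_exists R _ (qsize_gt0 Q))).

Lemma qroot_prim Q : (qsize Q).-primitive_root (qroot Q).
Proof. by rewrite /qroot; case: cid. Qed.

Definition qchar Q (w : C) (n : nat) : C := w ^+ ilog Q n.

Lemma qchar_unimodular Q w : normc w = 1 -> unimodular_char (qchar Q w).
Proof.
move=> w1; split => [n _|a b a0 b0]; first by rewrite normcX w1 expr1n.
by rewrite /qchar ilogM // exprD.
Qed.

Lemma qchar_unimodular_root Q j : unimodular_char (qchar Q (qroot Q ^+ j)).
Proof. by apply/qchar_unimodular/(normc_root (qsize_gt0 Q) (qroot_prim Q)). Qed.

Definition qavg (K : fieldType) Q (phi : (nat -> C) -> K) : K :=
  avg (qsize Q) (fun j => phi (qchar Q (qroot Q ^+ j))).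

Lemma ilog_lt_qsize n c : (0 < n)%N ->
  \forall Q \near \oo, (c * (ilog Q n).+1 < qsize Q)%N.
Proof.
move=> n0; exists (c * n.+1)%N => // Q /= hQ.
have := ilog_le Q n0; rewrite /qsize -mulnn; nia.
Qed.

(** For Q large, ilog Q separates a from b and takes both below the order of
the group, so orthogonality of distinct frequencies applies. *)
Lemma qavg_orth a b : (0 < a)%N -> (0 < b)%N -> \forall Q \near \oo,
  qavg Q (fun chi => chi a * ((chi b)^*)%C) = (a == b)%:R.
Proof.
move=> a0 b0.
have lt c d : (0 < c)%N -> (c < d)%N -> \forall Q \near \oo, (ilog Q c < ilog Q d)%N.
  by move=> c0 cd; exists (c * 2 ^ d)%N => // Q /=; apply: ilog_ltn.
have ab : \forall Q \near \oo, (ilog Q a == ilog Q b) = (a == b).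
  have [h|h|->] := ltngtP a b; last by near=> Q; rewrite eqxx.
    by apply: filterS (lt _ _ a0 h) => Q hQ; apply/negbTE; rewrite neq_ltn hQ.
  by apply: filterS (lt _ _ b0 h) => Q hQ; apply/negbTE; rewrite neq_ltn hQ orbT.
apply: filterS3 ab (ilog_lt_qsize 1 a0) (ilog_lt_qsize 1 b0) => Q hQ ha hb.
by rewrite /qavg (avg_orth (qsize_gt0 Q) (qroot_prim Q)) ?hQ //; lia.
Unshelve. all: by end_near.
Qed.

Lemma qavg_trigval s :
  posfreq s -> \forall Q \near \oo, qavg Q (trigval s) = trigmean s.
Proof.
elim: s => [|x s IH] /=.
  move=> _; near=> Q; rewrite /trigmean big_nil /qavg /avg big1 ?mulr0 //.
  by move=> j _; rewrite /trigval big_nil.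
move=> /andP[/andP[x1 x2] /IH {}IH].
apply: filterS2 IH (qavg_orth x1 x2) => Q hQ1 hQ2.
rewrite /trigmean big_cons -/(trigmean s).
rewrite (_ : qavg Q (trigval (x :: s)) =
  x.1 * qavg Q (fun chi => chi x.2.1 * ((chi x.2.2)^*)%C) + qavg Q (trigval s)).
  rewrite hQ1 hQ2.
  by case: eqP => _; rewrite ?mulr1 // mulr0 add0r.
rewrite /qavg -avgZ -avgD; apply: eq_avg => j.
by rewrite /trigval big_cons.
Unshelve. all: by end_near.
Qed.

End Characters.

(** * Means over the vertical line *)

Section VerticalMean.
Variable R : realType.
Local Notation C := R[i].
Implicit Types (f g : R -> R).

Definition tmean f T : R :=
  (2 * T)^-1 * \int[lebesgue_measure]_(t in `[- T, T]) f t.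

Lemma tmean_integrable f T : continuous f ->
  lebesgue_measure.-integrable `[- T, T] (EFin \o f).
Proof.
move=> cf; apply: continuous_compact_integrable; first exact: segment_compact.
exact: continuous_subspaceT.
Qed.

Lemma tmeanD f g T : continuous f -> continuous g ->
  tmean (fun t => f t + g t) T = tmean f T + tmean g T.
Proof.
by move=> cf cg; rewrite /tmean RintegralD ?mulrDr //; exact: tmean_integrable.
Qed.

Lemma tmean_cst c T : 0 < T -> tmean (fun=> c) T = c.
Proof.
move=> T0; rewrite /tmean Rintegral_cst //= lebesgue_measure_itv /= lte_fin.
by rewrite gtrN // opprK /=; field; lra.
Qed.

Lemma ler_tmean f g T : 0 < T -> continuous f -> continuous g ->
  (forall t, f t <= g t) -> tmean f T <= tmean g T.
Proof.
move=> T0 cf cg fg; rewrite /tmean ler_wpM2l //;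
  first by rewrite invr_ge0 mulr_ge0 // ltW.
by apply: le_Rintegral => //; exact: tmean_integrable.
Qed.

Lemma tmean_dist f g T (e : R) : 0 < T -> continuous f -> continuous g ->
  (forall t, `|f t - g t| <= e) -> `|tmean f T - tmean g T| <= e.
Proof.
move=> T0 cf cg fg; have cce : continuous (fun _ : R => e) by exact: cst_continuous.
have aux u v : continuous u -> continuous v -> (forall t, u t <= v t + e) ->
    tmean u T <= tmean v T + e.
  move=> cu cv uv; rewrite -[X in _ + X](tmean_cst e T0) -tmeanD //.
  by apply: ler_tmean => // t; apply: cvgD; [exact: cv|exact: cce].
have h1 : tmean f T <= tmean g T + e.
  by apply: aux => // t; have := fg t; rewrite ler_distl; lra.
have h2 : tmean g T <= tmean f T + e.
  by apply: aux => // t; have := fg t; rewrite ler_distl; lra.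
by rewrite ler_distl; apply/andP; split; lra.
Qed.

Definition sinusoid (a b d t : R) : R := a * cos (t * d) + b * sin (t * d).

Lemma is_derive_sinusoid (a b d t : R) :
  is_derive t 1 (sinusoid a b d) (d * sinusoid b (- a) d t).
Proof.
have h (u u' : R -> R) : (forall x : R, is_derive x 1 u (u' x)) ->
    is_derive t 1 (fun t => u (t * d)) (d * u' (t * d)).
  move=> hu.
  have -> : (fun t => u (t * d)) = u \o (fun t => t * d) by [].
  have hm : is_derive t 1 ( *%R^~ d) d.
    by apply: is_derive_eq; rewrite scaler0 add0r; exact: mulr1.
  by rewrite mulrC; apply: is_derive1_comp.
have hc := h _ _ (@is_derive_cos R); have hs := h _ _ (@is_derive_sin R).
rewrite /sinusoid; apply: is_derive_eq.
rewrite /GRing.scale /=; ring.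
Qed.

Lemma continuous_sinusoid a b d : continuous (sinusoid a b d).
Proof.
move=> t; apply: differentiable_continuous; apply/derivable1_diffP.
by have [] := is_derive_sinusoid a b d t.
Qed.

Lemma tmean_sinusoid (a b d : R) :
  tmean (sinusoid a b d) T @[T --> +oo] --> (if d == 0 then a else 0).
Proof.
case: eqP => [->|/eqP d0].
  have -> : sinusoid a b 0 = fun=> a.
    by apply/funext => t; rewrite /sinusoid mulr0 cos0 sin0 mulr1 mulr0 addr0.
  apply: cvg_near_cst; near=> T; apply: tmean_cst.
  by near: T; apply: nbhs_pinfty_gt; rewrite num_real.
pose F := sinusoid (- b / d) (a / d) d.
have dF (t : R) : is_derive t 1 F (sinusoid a b d t).
  apply: is_derive_eq (is_derive_sinusoid _ _ _ _) _.
  by rewrite /sinusoid; field.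
have Fb (t : R) : `|F t| <= `|b / d| + `|a / d|.
  rewrite /F /sinusoid; apply: le_trans (ler_normD _ _) _; rewrite !normrM normrN.
  have hs : `|sin (t * d)| <= 1 by rewrite ler_norml sin_geN1 sin_le1.
  have hc : `|cos (t * d)| <= 1 by rewrite ler_norml cos_geN1 cos_le1.
  by apply: lerD; rewrite ler_piMr // mulr_ge0.
set M := _ + _ in Fb.
have bound T : 0 < T -> `|tmean (sinusoid a b d) T| <= M / T.
  move=> T0; rewrite /tmean /Rintegral (@continuous_FTC2 _ _ F) ?gtrN //=.
  - rewrite normrM gtr0_norm ?invr_gt0 ?mulr_gt0 // invfM mulrAC ler_wpM2r //.
      by rewrite invr_ge0 ltW.
    have := ler_normB (F T) (F (- T)); have := Fb T; have := Fb (- T); lra.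
  - exact/continuous_subspaceT/continuous_sinusoid.
  - have cF t : {for t, continuous F} by apply: continuous_sinusoid.
    split.
    + by move=> t _; have [] := dF t.
    + by apply: cvg_at_right_filter; exact: cF.
    + by apply: cvg_at_left_filter; exact: cF.
  - by move=> t _; rewrite derive1E derive_val.
apply/cvgrPdist_le => e e0; near=> T.
rewrite sub0r normrN; have T0 : 0 < T by near: T; apply: nbhs_pinfty_gt;
  rewrite num_real.
apply: le_trans (bound _ T0) _; rewrite ler_pdivrMr // mulrC -ler_pdivrMr //.
Unshelve. all: by end_near.
Qed.

Definition tchar (t : R) (n : nat) : C := cpown n (- (0 +i* t)%C).

Lemma tcharE t n : (0 < n)%N ->
  tchar t n = (cos (t * ln n%:R) -i* sin (t * ln n%:R))%C.
Proof.
move=> n0; rewrite /tchar /cpown /= oppr0 powRr0 mul1r mulNr cosN sinN.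
by [].
Qed.

Lemma tchar_unimodular t : unimodular_char (tchar t).
Proof.
split => [n n0|a b a0 b0].
  by rewrite tcharE //= sqrrN cos2Dsin2 sqrtr1.
rewrite !tcharE ?muln_gt0 ?a0 // natrM lnM ?posrE ?ltr0n // mulrDr cosD sinD.
by apply/eqP; rewrite eq_complex /=; apply/andP; split; apply/eqP; ring.
Qed.

Lemma Re_trigval s t : posfreq s -> complex.Re (trigval s (tchar t)) =
  \sum_(x <- s) sinusoid (complex.Re x.1) (complex.Im x.1)
       (ln x.2.1%:R - ln x.2.2%:R) t.
Proof.
move=> s0; rewrite /trigval (raddf_sum (@complex.Re R)).
rewrite big_seq [RHS]big_seq; apply: eq_bigr => x xs.
have /andP[x1 x2] := allP s0 _ xs; rewrite !tcharE // /sinusoid mulrBr cosB sinB.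
by case: (x.1) => a b /=; ring.
Qed.

Lemma continuous_sum_sinusoid (s : seq (C * (nat * nat))) :
  continuous (fun t => \sum_(x <- s) sinusoid (complex.Re x.1) (complex.Im x.1)
       (ln x.2.1%:R - ln x.2.2%:R) t).
Proof.
elim: s => [|x s IH] t.
  under eq_fun do rewrite big_nil; exact: cvg_cst.
under eq_fun do rewrite big_cons.
by apply: cvgD; [exact: continuous_sinusoid|exact: IH].
Qed.

Lemma continuous_Re_trigval s : posfreq s ->
  continuous (fun t => complex.Re (trigval s (tchar t))).
Proof.
by move=> s0; under eq_fun do rewrite Re_trigval //; exact: continuous_sum_sinusoid.
Qed.

(** The frequency log a - log b vanishes exactly when a = b, so only the diagonal
terms have a nonzero mean. *)
Lemma tmean_trigval s : posfreq s ->
  tmean (fun t => complex.Re (trigval s (tchar t))) T @[T --> +oo] -->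
  complex.Re (trigmean s).
Proof.
move=> s0; under eq_fun do under eq_fun do rewrite Re_trigval //.
elim: s s0 => [|x s IH] /=.
  move=> _; rewrite /trigmean big_nil /=.
  under eq_fun do under eq_fun do rewrite big_nil.
  apply: cvg_near_cst; near=> T; apply: tmean_cst.
  by near: T; apply: nbhs_pinfty_gt; rewrite num_real.
move=> /andP[/andP[x1 x2] /IH {}IH].
under eq_fun do under eq_fun do rewrite big_cons.
under eq_fun do rewrite (tmeanD _ (@continuous_sinusoid _ _ _)
  (@continuous_sum_sinusoid _)).
rewrite /trigmean big_cons -/(trigmean s).
have -> : complex.Re (if x.2.1 == x.2.2 then x.1 + trigmean s else trigmean s) =
   (if ln x.2.1%:R - ln x.2.2%:R == 0 :> R then complex.Re x.1 else 0)
   + complex.Re (trigmean s).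
  rewrite subr_eq0 (inj_in_eq (@ln_inj R)) ?posrE ?ltr0n // eqr_nat.
  by case: eqP => _; rewrite ?raddfD ?add0r.
apply: cvgD IH; exact: tmean_sinusoid.
Unshelve. all: by end_near.
Qed.

End VerticalMean.

(** * The norm as a limit of finite averages *)

Section Bridge.
Variable R : realType.
Local Notation C := R[i].

Lemma cauchy_seq_cvg (u : nat -> R) :
  (forall e : R, 0 < e -> exists K, forall m n, (K <= m)%N -> (K <= n)%N ->
    `|u m - u n| < e) -> cvgn u.
Proof.
move=> h; apply/cauchy_cvgP/cauchy_ballP => e e0.
have [K hK] := h e e0.
pose A := u @` [set n | (K <= n)%N].
exists (A, A); last by move=> _ [[m Km <-] [n Kn <-]] /=; apply: hK.
by split; exists K => // n Kn; exists n.
Qed.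

(** A trigonometric polynomial g playing the role of the conjugate sign of p: it
never exceeds 1 in modulus and its product with p is a real function within e
of |p|, uniformly in the character. The same g approximates |p| by the
trigonometric polynomial psi, and dualizes the L^1 norm. *)
Lemma sign_approx (p : dirpoly R) (e : R) : 0 < e ->
  exists g : (nat -> C) -> C, exists2 psi : (nat -> C) -> R, trigpoly g &
  forall chi, unimodular_char chi ->
    [/\ normc (g chi) <= 1, dirval p chi * g chi = (psi chi)%:C%C &
        normc (dirval p chi) - e <= psi chi <= normc (dirval p chi)].
Proof.
move=> e0; pose B := coef_norm1 p + 1.
have B0 : 0 < B by rewrite ltr_wpDl // sumr_ge0 // => k _; apply: normc_ge0.
(* j is large enough for B times the error 2 / (j + 2) to be at most e *)
pose j := Num.truncn (2 * B / e).
have je : B * (2 / j.+2%:R) <= e.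
  have : 2 * B / e < j.+2%:R.
    by apply: lt_le_trans (truncnS_gt _) _; rewrite ler_nat.
  rewrite ltr_pdivrMr // => h; rewrite mulrA ler_pdivrMr // mulrC; lra.
pose u chi := normc (dirval p chi) / B.
exists (fun chi => ((dirval p chi)^*)%C * (invsqrt_approx j (u chi ^+ 2) / B)%:C%C).
exists (fun chi => B * (u chi ^+ 2 * invsqrt_approx j (u chi ^+ 2))).
  apply: trigpolyM; first exact/trigpoly_conj/trigpoly_dirval.
  have hv : trigpoly (fun chi : nat -> C => (u chi ^+ 2)%:C%C).
    apply: eq_trigpoly (trigpolyZ ((B ^+ 2)^-1)%:C%C
      (trigpoly_sqr_normc (trigpoly_dirval p))) => chi _.
    by rewrite -rmorphM /u expr_div_n mulrC.
  apply: eq_trigpoly (trigpolyZ (B^-1)%:C%C (trigpoly_invsqrt j hv)) => chi _.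
  by rewrite -rmorphM mulrC.
move=> chi hchi; have nB : normc (dirval p chi) <= B.
  by apply: le_trans (dirval_le p hchi) _; rewrite lerDl.
have uB : normc (dirval p chi) = B * u chi.
  by rewrite /u mulrC divfK // gt_eqF.
have u01 : 0 <= u chi <= 1.
  by rewrite /u divr_ge0 ?normc_ge0 ?(ltW B0) //= ler_pdivrMr // mul1r.
have [h1 h2 /andP[h3 h4]] := invsqrt_approxP j u01.
set r := invsqrt_approx _ _ in h1 h2 h3 h4 *.
split.
- rewrite normcM normc_conj normc_real ger0_norm ?divr_ge0 ?(ltW B0) //.
  by rewrite uB mulrC mulrA divfK ?gt_eqF // mulrC.
- rewrite mulrA mulc_conj -rmorphM uB; congr (_%:C%C); field.
  by rewrite gt_eqF.
- rewrite uB; apply/andP; split; last by rewrite ler_pM2l // -subr_ge0.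
  have : B * (u chi - u chi ^+ 2 * r) <= B * (2 / j.+2%:R) by rewrite ler_pM2l.
  by move=> /le_trans/(_ je); rewrite mulrBr; lra.
Qed.

Definition qnorm Q (p : dirpoly R) : R := qavg Q (fun chi => normc (dirval p chi)).

Lemma continuous_normc_dirval (p : dirpoly R) : continuous (fun t : R =>
  normc (dirval p (tchar t))).
Proof.
have [s s0 hs] := trigpoly_sqr_normc (trigpoly_dirval p).
have -> : (fun t : R => normc (dirval p (tchar t))) =
    Num.sqrt \o (fun t => complex.Re (trigval s (tchar t))).
  apply/funext => t /=; rewrite -hs /=; last exact: tchar_unimodular.
  by rewrite sqrtr_sqr ger0_norm // normc_ge0.
move=> t; apply: continuous_comp; first exact: continuous_Re_trigval.
exact: sqrt_continuous.
Qed.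

(** The constant c is the mean of the trigonometric polynomial that is uniformly
close to |p|. It does not depend on the family of characters, which ties the
vertical means to the finite averages. *)
Lemma mean_norm_approx (p : dirpoly R) (e : R) : 0 < e -> exists c : R,
  (\forall T \near +oo, `|tmean (fun t => normc (dirval p (tchar t))) T - c| <= e)
  /\ (\forall Q \near \oo, `|qnorm Q p - c| <= e).
Proof.
move=> e0; have e20 : 0 < e / 2 by lra.
have [g [psi tg hg]] := sign_approx p e20.
have [s s0 hs] := trigpolyM (trigpoly_dirval p) tg.
have hpsi chi : unimodular_char chi -> psi chi = complex.Re (trigval s chi).
  by move=> hchi; rewrite -hs //; have [_ -> _] := hg _ hchi.
have close chi : unimodular_char chi ->
    `|normc (dirval p chi) - complex.Re (trigval s chi)| <= e / 2.
  move=> hchi; rewrite -hpsi //; have [_ _ /andP[h1 h2]] := hg _ hchi.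
  by rewrite ler_distl; apply/andP; split; lra.
exists (complex.Re (trigmean s)); split.
  have /cvgrPdist_le /(_ _ e20) lim_s := tmean_trigval s0.
  near=> T.
  have T0 : 0 < T by near: T; apply: nbhs_pinfty_gt; rewrite num_real.
  have h1 : `|tmean (fun t => normc (dirval p (tchar t))) T -
      tmean (fun t => complex.Re (trigval s (tchar t))) T| <= e / 2.
    apply: tmean_dist => //; first exact: continuous_normc_dirval.
      exact: continuous_Re_trigval.
    by move=> t; apply/close/tchar_unimodular.
  have h2 : `|complex.Re (trigmean s) -
      tmean (fun t => complex.Re (trigval s (tchar t))) T| <= e / 2 by near: T.
  by move: h1 h2; rewrite !ler_distl => /andP[? ?] /andP[? ?]; apply/andP; split; lra.
apply: filterS (qavg_trigval s0) => Q hQ.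
have reQ : complex.Re (trigmean s) = qavg Q (fun chi => complex.Re (trigval s chi)).
  rewrite -hQ /qavg.
  have -> : avg (qsize Q) (fun j => trigval s (qchar Q (qroot R Q ^+ j))) =
    (avg (qsize Q) (fun j => psi (qchar Q (qroot R Q ^+ j))))%:C%C.
    rewrite -avg_real; apply: eq_avg => j.
    have hchi := qchar_unimodular_root R Q j.
    by rewrite -hs //; have [_ -> _] := hg _ hchi.
  by apply: eq_avg => j; rewrite hpsi //; apply: qchar_unimodular_root.
rewrite reQ /qnorm /qavg -avgB ler_norml -[- e](avg_cst (qsize_gt0 Q)).
rewrite -[X in _ <= _ <= X](avg_cst (qsize_gt0 Q) e).
by apply/andP; split; apply: ler_avg => j;
  have := close _ (qchar_unimodular_root R Q j);
  rewrite ler_norml => /andP[? ?]; lra.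
Unshelve. all: by end_near.
Qed.

Lemma dirpoly_normE (p : dirpoly R) :
  dirpoly_norm p = lim (tmean (fun t => normc (dirval p (tchar t))) T @[T --> +oo]).
Proof. by []. Qed.

(** Both kinds of averages stay eventually within e of a common constant, for
each e; so both converge, to the same limit. *)
Theorem qnorm_cvg (p : dirpoly R) : qnorm Q p @[Q --> \oo] --> dirpoly_norm p.
Proof.
have cv : cvgn (qnorm ^~ p).
  apply: cauchy_seq_cvg => e e0; have e30 : 0 < e / 3 by lra.
  have [c [_ [K _ hK]]] := mean_norm_approx p e30.
  exists K => m n /hK /= h1 /hK /= h2.
  by move: h1 h2; rewrite !ler_distl ltr_distl => /andP[? ?] /andP[? ?];
    apply/andP; split; lra.
suff -> : dirpoly_norm p = lim (qnorm Q p @[Q --> \oo]) by [].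
rewrite dirpoly_normE; apply/cvg_lim => //; set l := lim _.
have cvl : qnorm Q p @[Q --> \oo] --> l by [].
apply/cvgrPdist_le => e e0; have e30 : 0 < e / 3 by lra.
have [c [hT hQ]] := mean_norm_approx p e30.
have lc : `|l - c| <= e / 3.
  have h : (`|qnorm Q p - c|) @[Q --> \oo] --> `|l - c|.
    by apply: cvg_norm; apply: cvgB => //; apply: cvg_cst.
  by have := limr_le (cvgP _ h) hQ; rewrite (cvg_lim (@Rhausdorff R) h); apply.
apply: filterS hT => T; move: lc.
by rewrite !ler_distl => /andP[? ?] /andP[? ?]; apply/andP; split; lra.
Qed.

End Bridge.

(** * One-variable kernels and truncations *)

Section OneVariable.
Variables (R : realType) (m : nat) (z : R[i]).
Local Notation C := R[i].
Hypothesis m_gt0 : (0 < m)%N.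
Hypothesis z_prim : m.-primitive_root z.
Local Notation E := (avg m).

Lemma avg_geom_sqr n : (n <= m)%N ->
  E (fun j => normc (\sum_(r < n) z ^+ j ^+ r) ^+ 2) = n%:R.
Proof.
move=> nm; have := @Parseval _ _ _ m_gt0 z_prim _ (index_enum 'I_n)
  (fun=> 1) (@nat_of_ord n) (index_enum_uniq _).
have inj : {in index_enum 'I_n &, injective (@nat_of_ord n)}.
  by move=> i k _ _; apply: val_inj.
have lt : {in index_enum 'I_n, forall i, (nat_of_ord i < m)%N}.
  by move=> i _; apply: leq_trans (ltn_ord i) nm.
move=> /(_ inj lt) h; rewrite -[RHS](_ : \sum_(i < n) normc (1 : C) ^+ 2 = _).
  rewrite -[RHS]h; apply: eq_avg => j; congr (normc _ ^+ 2).
  by apply: eq_bigr => i _; rewrite mul1r.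
by rewrite normc1 expr1n sumr_const card_ord.
Qed.

(** h is the convolution of f with the normalized product of the two geometric
sums of lengths L and 2 L. Its Fourier coefficients form a trapezoid, equal to 1
on [0, L] and to 0 beyond 2 L. As 2 |A B| <= |A|^2 + |B|^2, Parseval bounds its
L^1 norm by 3/2. *)
Lemma Vallee_Poussin (f : {poly C}) L : (0 < L)%N -> (size f + 2 * L <= m)%N ->
  exists h : {poly C},
  [/\ E (fun j => normc h.[z ^+ j]) <= 2 * E (fun j => normc f.[z ^+ j]),
      forall l, (l <= L)%N -> h`_l = f`_l,
      forall l, (2 * L <= l)%N -> h`_l = 0 &
      forall l, f`_l = 0 -> h`_l = 0].
Proof.
move=> L0 fm.
pose A j := \sum_(r < L) z ^+ j ^+ r : C.
pose B j := \sum_(s < 2 * L) z ^+ j ^+ s : C.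
(* the coefficient of ker at degree - l is the number of pairs r < L, s < 2 L with
   s - r = l, divided by L *)
pose ker j := (L%:R)^-1 * (A j * ((B j)^*)%C).
pose v l := E (fun j => z ^+ j ^+ l * ker j).
have LC : (L%:R : C) != 0 by rewrite pnatr_eq0 -lt0n.
have vE l : (l + L <= m)%N -> (2 * L <= m)%N -> v l = (L%:R)^-1 *
    \sum_(r < L) \sum_(s < 2 * L) ((l + r)%N == s :> nat)%:R.
  move=> lm Lm; rewrite /v.
  rewrite (_ : E _ = E (fun j => (L%:R)^-1 * \sum_(r < L) \sum_(s < 2 * L)
      z ^+ j ^+ (l + r) * ((z ^+ j ^+ s)^*)%C)); last first.
    apply: eq_avg => j; rewrite /ker mulrCA; congr (_ * _).
    rewrite /A /B mulr_suml mulr_sumr; apply: eq_bigr => r _.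
    rewrite (rmorph_sum (@conjc R)) !mulr_sumr; apply: eq_bigr => s _.
    by rewrite exprD mulrA.
  rewrite avgZ avg_sum; congr (_ * _); apply: eq_bigr => r _.
  rewrite avg_sum; apply: eq_bigr => s _; rewrite (avg_orth m_gt0 z_prim) //.
    by apply: leq_trans lm; rewrite ltn_add2l.
  exact: leq_trans (ltn_ord s) Lm.
have v1 l : (l <= L)%N -> (l + L <= m)%N -> (2 * L <= m)%N -> v l = 1.
  move=> lL lm Lm; rewrite vE //.
  rewrite (eq_bigr (fun=> 1)) ?sumr_const ?card_ord ?mulVf // => r _.
  have rl : (l + r < 2 * L)%N by have := ltn_ord r; lia.
  rewrite (bigD1 (Ordinal rl)) //= eqxx big1 ?addr0 // => s sr.
  rewrite (_ : _ == _ = false) //; apply/negbTE; apply: contra sr => /eqP sr.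
  exact/eqP/val_inj.
have v0 l : (2 * L <= l)%N -> (l + L <= m)%N -> v l = 0.
  move=> lL lm; rewrite vE //; last by lia.
  rewrite big1 ?mulr0 // => r _; rewrite big1 // => s _.
  by rewrite (_ : _ == _ = false) //; apply/negbTE; have := ltn_ord s; lia.
exists (\poly_(l < size f) (v l * f`_l)); split.
- have hE i : (\poly_(l < size f) (v l * f`_l)).[z ^+ i] =
      E (fun j => ker j * f.[z ^+ i * z ^+ j]).
    rewrite horner_poly.
    rewrite (_ : E _ = E (fun j => \sum_(l < size f) (f`_l * z ^+ i ^+ l) *
       (z ^+ j ^+ l * ker j))); last first.
      apply: eq_avg => j; rewrite horner_coef mulr_sumr; apply: eq_bigr => l _.
      by rewrite exprMn; ring.
    by rewrite avg_sum; apply: eq_bigr => l _; rewrite avgZ -/(v l); ring.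
  apply: le_trans (_ : E (fun j => normc (ker j)) *
      E (fun j => normc f.[z ^+ j]) <= _); last first.
    apply: ler_wpM2r; first by apply: avg_ge0 => j; apply: normc_ge0.
    apply: le_trans (_ : E (fun j => ((L%:R)^-1 / 2) *
       (normc (A j) ^+ 2 + normc (B j) ^+ 2)) <= _).
      apply: ler_avg => j.
      rewrite /ker !normcM normc_conj normcV normc_nat -mulrA ler_wpM2l ?invr_ge0 //.
      by have := sqr_ge0 (normc (A j) - normc (B j)); nra.
    rewrite avgZ avgD !avg_geom_sqr; [|lia..].
    rewrite natrM; have : (L%:R : R) != 0 by rewrite pnatr_eq0 -lt0n.
    move=> LR; have -> : L%:R^-1 / 2 * (L%:R + 2 * L%:R) = 3 / 2 :> R by field.
    lra.
  apply: le_trans (_ : E (fun i => E (fun j =>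
     normc (ker j) * normc f.[z ^+ i * z ^+ j])) <= _).
    apply: ler_avg => i; rewrite hE; apply: le_trans (normc_avg _ _) _.
    by apply: ler_avg => j; rewrite normcM.
  rewrite avg_exchange mulrC -avgZ; apply: ler_avg => j.
  by rewrite avgZ mulrC (avg_shift m_gt0 z_prim (fun w => normc f.[w])).
- move=> l lL; rewrite coef_poly; case: ltnP => lf; last by rewrite nth_default.
  by rewrite v1 ?mul1r //; lia.
- move=> l lL; rewrite coef_poly; case: ltnP => // lf.
  by rewrite v0 ?mul0r //; lia.
- by move=> l fl; rewrite coef_poly fl mulr0 if_same.
Qed.

(** Both sides are the coefficient of degree D of a product: keeping the degrees
below s of h amounts to keeping the degrees above D - s of G. *)
Lemma truncation_duality (h G : {poly C}) D s :
  (size h + size G <= m)%N -> (D < m)%N ->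
  E (fun j => (take_poly s h).[z ^+ j] * (G.[z ^+ j] * ((z ^+ j ^+ D)^*)%C)) =
  E (fun j => h.[z ^+ j] * ((poly_tail (D.+1 - s) G).[z ^+ j] * ((z ^+ j ^+ D)^*)%C)).
Proof.
move=> hm Dm.
have aux (u v : {poly C}) : (size u <= size h)%N -> (size v <= size G)%N ->
    E (fun j => u.[z ^+ j] * (v.[z ^+ j] * ((z ^+ j ^+ D)^*)%C)) = (u * v)`_D.
  move=> uh vG; rewrite -(avg_coef m_gt0 z_prim) //.
    by apply: eq_avg => j; rewrite hornerM mulrA.
  apply: leq_trans (size_polyMleq _ _) _; lia.
rewrite !aux ?size_poly_tail //.
  rewrite !coefM; apply: eq_bigr => -[i iD] _ /=.
  rewrite coef_take_poly coef_poly_tail.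
  by case: ltnP => is_; case: ltnP => di; rewrite ?mul0r ?mulr0 //; lia.
by apply/leq_sizeP => i ih; rewrite coef_take_poly nth_default // if_same.
Qed.

End OneVariable.

(** * The partial sum operator at a fixed sampling level *)

Lemma size_take_poly_le (K : nzRingType) N (p : {poly K}) :
  (size (take_poly N p) <= size p)%N.
Proof.
by apply/leq_sizeP => i ip; rewrite coef_take_poly nth_default // if_same.
Qed.

Section Lift.
Variables (R : realType) (Q : nat).
Local Notation C := R[i].
Local Notation m := (qsize Q).
Local Notation z := (qroot R Q).
Local Notation E := (avg m).
Let m_gt0 := qsize_gt0 Q.
Let z_prim := qroot_prim R Q.

Lemma sum_eq_index (V : nmodType) (r : seq nat) (a : nat) (F : V) : uniq r ->
  a \in r -> \sum_(k <- r | a == k) F = F.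
Proof.
move=> ur ar; rewrite -big_filter (eq_filter (a2 := pred1 a)).
  by rewrite filter_pred1_uniq // big_seq1.
by move=> k /=; rewrite eq_sym.
Qed.

Lemma count_factor_pairs (r : seq nat) k : uniq r -> (0 < k)%N ->
  (count (fun x => x.1 * x.2 == k)%N [seq (a, b) | a <- r, b <- r]
     <= size (divisors k))%N.
Proof.
move=> ur k0; rewrite -size_filter; set s := (X in (size X <= _)%N).
have us : uniq s by rewrite filter_uniq // allpairs_uniq // => -[a b] [c d].
rewrite -(size_map fst); apply: uniq_leq_size.
  rewrite map_inj_in_uniq // => -[a b] [c d]; rewrite !mem_filter /=.
  move=> /andP[/eqP abk _] /andP[/eqP cdk _] ac; rewrite -ac in cdk *.
  have a0 : (0 < a)%N by case: a abk {ac cdk} => //; lia.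
  by congr pair; apply/eqP; rewrite -(eqn_pmul2l a0) abk cdk.
move=> d /mapP[[a b]]; rewrite mem_filter /= => /andP[/eqP abk _] ->.
by rewrite -dvdn_divisors // -abk dvdn_mulr.
Qed.

(** The coefficient of H^2 at ilog Q k collects the pairs with product k; there
are at most D of them, and Cauchy-Schwarz costs a factor D in Parseval's
formula. *)
Lemma lifted_norm4_le (r : seq nat) (c : nat -> C) (D : R) M : uniq r ->
  {in r, forall n, 0 < n < M}%N ->
  (forall a b, 0 < a < M ^ 2 -> 0 < b < M ^ 2 -> ilog Q a = ilog Q b -> a = b)%N ->
  (forall k, 0 < k < M ^ 2 -> ilog Q k < m)%N ->
  (forall k, (0 < k < M ^ 2)%N -> (size (divisors k))%:R <= D) ->
  forall H : nat -> R,
  (forall j, H j = normc (\sum_(n <- r) c n * z ^+ j ^+ ilog Q n)) ->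
  E (fun j => H j ^+ 4) <= D * E (fun j => H j ^+ 2) ^+ 2.
Proof.
move=> ur rM inj lt hD H HE.
pose rr := [seq (a, b) | a <- r, b <- r].
pose kk := iota 1 (M ^ 2).-1.
have kkE k : (k \in kk) = (0 < k < M ^ 2)%N by rewrite mem_iota; lia.
have ukk : uniq kk by rewrite iota_uniq.
have rrkk x : x \in rr -> (x.1 * x.2)%N \in kk.
  case/allpairsP => -[a b] /= [ar br ->] /=; rewrite kkE.
  by have := rM _ ar; have := rM _ br; rewrite -mulnn; nia.
pose e k := \sum_(x <- rr | (x.1 * x.2 == k)%N) c x.1 * c x.2.
have regroup (V : nmodType) (F : nat * nat -> V) :
    \sum_(k <- kk) \sum_(x <- rr | (x.1 * x.2 == k)%N) F x = \sum_(x <- rr) F x.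
  rewrite (exchange_big_dep xpredT) //= big_seq [RHS]big_seq.
  by apply: eq_bigr => x /rrkk xk; rewrite sum_eq_index.
have H4 j : H j ^+ 4 = normc (\sum_(k <- kk) e k * z ^+ j ^+ ilog Q k) ^+ 2.
  have -> : H j ^+ 4 = normc ((\sum_(n <- r) c n * z ^+ j ^+ ilog Q n) ^+ 2) ^+ 2.
    by rewrite HE normcX -exprM.
  congr (normc _ ^+ 2).
  under [RHS]eq_bigr => k _.
    rewrite mulr_suml (eq_bigr (fun x =>
      c x.1 * c x.2 * z ^+ j ^+ ilog Q (x.1 * x.2))).
      over.
    by move=> x /eqP ->.
  rewrite regroup expr2 mulr_suml big_allpairs_dep big_seq [RHS]big_seq.
  apply: eq_bigr => a ar; rewrite mulr_sumr big_seq [RHS]big_seq.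
  apply: eq_bigr => b br /=; have /andP[a0 _] := rM _ ar; have /andP[b0 _] := rM _ br.
  by rewrite ilogM // exprD; ring.
have H2 j : H j ^+ 2 = normc (\sum_(n <- r) c n * z ^+ j ^+ ilog Q n) ^+ 2.
  by rewrite HE.
rewrite (eq_avg _ H4) (eq_avg _ H2) (Parseval m_gt0 z_prim) //; last 2 first.
- by move=> a b; rewrite !kkE => ha hb; apply: inj.
- by move=> k; rewrite kkE => /lt.
rewrite (Parseval m_gt0 z_prim) //; last 2 first.
- move=> a b /rM ha /rM hb; apply: inj; rewrite -mulnn; nia.
- move=> k /rM hk; apply: lt; rewrite -mulnn; nia.
have -> : (\sum_(n <- r) normc (c n) ^+ 2) ^+ 2 =
    \sum_(k <- kk) \sum_(x <- rr | (x.1 * x.2 == k)%N) (normc (c x.1) * normc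
      (c x.2)) ^+ 2.
  rewrite regroup expr2 mulr_suml big_allpairs_dep; apply: eq_bigr => a _.
  by rewrite mulr_sumr; apply: eq_bigr => b _; rewrite exprMn.
rewrite mulr_sumr big_seq [leRHS]big_seq; apply: ler_sum => k; rewrite kkE => kM.
apply: le_trans (_ : (\sum_(x <- rr | (x.1 * x.2 == k)%N)
    1 * (normc (c x.1) * normc (c x.2))) ^+ 2 <= _).
  rewrite ler_sqr ?nnegrE ?normc_ge0 //; last first.
    by apply: sumr_ge0 => x _; rewrite !mulr_ge0 ?normc_ge0.
  apply: le_trans (normc_sum _ _ _) _; apply: ler_sum => x _.
  by rewrite mul1r normcM.
apply: le_trans (sum_CauchySchwarz _ _ _ _) _; apply: ler_wpM2r.
  by apply: sumr_ge0 => x _; rewrite sqr_ge0.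
apply: le_trans (hD _ kM); rewrite (eq_bigr (fun=> 1%:R)) => [|x _]; last first.
  by rewrite expr1n.
rewrite -natr_sum sum1_count ler_nat; apply: count_factor_pairs => //.
by case/andP: kM.
Qed.

Definition lift n (p : dirpoly R) : {poly C} :=
  \sum_(k < n) p`_k *: 'X^(ilog Q k.+1).

Lemma horner_lift n (p : dirpoly R) w : (size p <= n)%N ->
  (lift n p).[w] = dirval p (qchar Q w).
Proof.
move=> pn; rewrite (dirval_wide _ pn) /lift horner_sum.
by apply: eq_bigr => k _; rewrite hornerZ hornerXn.
Qed.

(** On the sampled characters a trigonometric polynomial is a Laurent polynomial
in w, written as G(w) conj(w^D) with G an ordinary polynomial. *)
Lemma trigval_laurent s : posfreq s -> exists G : {poly C}, exists2 D,
  (D < (Q * \sum_(x <- s) (x.2.1 + x.2.2)).+1 /\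
  size G <= (Q * \sum_(x <- s) (x.2.1 + x.2.2)).+1)%N &
  forall j, trigval s (qchar Q (z ^+ j)) = G.[z ^+ j] * ((z ^+ j ^+ D)^*)%C.
Proof.
move=> s0; pose D := (\sum_(x <- s) ilog Q x.2.2)%N.
have DE : (D <= Q * \sum_(x <- s) x.2.2)%N.
  rewrite /D big_distrr /= big_seq [leqRHS]big_seq; apply: leq_sum => x xs.
  by apply: ilog_le; have /andP[] := allP s0 _ xs.
have xD x : x \in s -> (ilog Q x.2.2 <= D)%N.
  by move=> xs; rewrite /D (big_rem x) //= leq_addr.
pose G : {poly C} := \sum_(x <- s) x.1 *: 'X^(D + ilog Q x.2.1 - ilog Q x.2.2).
exists G, D; first split.
- by rewrite ltnS big_split /= mulnDr (leq_trans DE) // leq_addl.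
- rewrite /G big_seq; apply: leq_trans (size_sum _ _ _) _.
  apply/bigmax_leqP_seq => x xs xs'; apply: leq_trans (size_scale_leq _ _) _.
  rewrite size_polyXn ltnS; apply: leq_trans (leq_subr _ _) _.
  rewrite big_split /= mulnDr addnC leq_add //.
  have /andP[x1 _] := allP s0 _ xs; apply: leq_trans (ilog_le Q x1) _.
  by rewrite leq_mul2l (big_rem x) //= leq_addr orbT.
move=> j; rewrite /trigval /G horner_sum mulr_suml big_seq [RHS]big_seq.
apply: eq_bigr => x xs; rewrite hornerZ hornerXn -mulrA; congr (_ * _).
have xd := xD _ xs; rewrite /qchar.
have -> : (D + ilog Q x.2.1 - ilog Q x.2.2 = ilog Q x.2.1 + (D - ilog Q x.2.2))%N.
  by lia.
have w1 := @normc_root _ _ _ m_gt0 z_prim.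
have -> : ((z ^+ j ^+ D)^*)%C =
    ((z ^+ j ^+ (D - ilog Q x.2.2))^*)%C * ((z ^+ j ^+ ilog Q x.2.2)^*)%C.
  by rewrite -(rmorphM (@conjc R)) -exprD subnK.
rewrite exprD -mulrA; congr (_ * _); rewrite mulrA mulc_conj normcX w1.
by rewrite !expr1n mul1r.
Qed.

Hypothesis Q_gt0 : (0 < Q)%N.

(** The upper bound at one sampling level Q. The integer B bounds all the indices
on which ilog Q has to be increasing, and the condition on m excludes any wrap
around modulo m. The pair g, psi comes from [sign_approx], and
2 ^ k.+1 is the exponent q. *)
Lemma lifted_truncation_bound (N k B : nat) (p : dirpoly R) (A e : R)
    (g : (nat -> C) -> C) (psi : (nat -> C) -> R) s :
  (1 < N)%N -> (size p <= B)%N -> (N ^ 4 <= B)%N -> 0 <= A -> 0 <= e ->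
  (forall a b, 0 < a -> a < b -> b <= B -> ilog Q a < ilog Q b)%N ->
  posfreq s ->
  ((Q * \sum_(x <- s) (x.2.1 + x.2.2)).+1 * 2 ^ k + 4 * (ilog Q B).+1 <= m)%N ->
  (forall chi, unimodular_char chi -> g chi = trigval s chi) ->
  (forall chi, unimodular_char chi ->
    [/\ normc (g chi) <= 1, dirval (take_poly N p) chi * g chi = (psi chi)%:C%C &
        normc (dirval (take_poly N p) chi) - e <= psi chi]) ->
  (forall l, (0 < l < N ^ 4)%N -> (size (divisors l))%:R <= A ^+ (2 ^ k.+1)) ->
  qnorm Q (take_poly N p) <= 2 * A * 2 ^+ k.+1 * qnorm Q p + e.
Proof.
move=> N1 pB NB A0 e0 mono s0 Qm hg hpsi hD.
have N0 : (0 < N)%N by apply: ltnW.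
have N4 : (N ^ 4 = (N ^ 2) ^ 2)%N by rewrite -expnM.
have N2 : (N <= N ^ 2)%N by rewrite -{1}[N]expn1 leq_exp2l.
have N24 : (N ^ 2 <= N ^ 4)%N by rewrite leq_exp2l.
have monoW a b : (0 < a)%N -> (a <= b)%N -> (b <= B)%N -> (ilog Q a <= ilog Q b)%N.
  move=> a0; rewrite leq_eqVlt => /orP[/eqP -> //|ab] bB; exact/ltnW/mono.
pose n := size p; pose L := ilog Q N; pose f := lift n p.
have L0 : (0 < L)%N by apply: leq_ltn_trans (mono 1%N N _ _ _) => //; lia.
have LB : (L <= ilog Q B)%N by apply: monoW => //; lia.
have sf : (size f <= (ilog Q B).+1)%N.
  apply: leq_trans (size_sum _ _ _) _; apply/bigmax_leqP => i _.
  apply: leq_trans (size_scale_leq _ _) _; rewrite size_polyXn ltnS.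
  by apply: monoW => //; apply: leq_trans pB.
have sfm : (size f + 2 * L <= m)%N by lia.
(* h agrees with f up to degree L and vanishes from degree 2 L = ilog Q (N^2) on *)
have [h [hE h1 h0 hf]] := Vallee_Poussin m_gt0 z_prim L0 sfm.
pose r := iota 1 (N ^ 2).-1.
have rE a : (a \in r) = (0 < a < N ^ 2)%N by rewrite mem_iota; lia.
have inj a b : (0 < a < N ^ 4)%N -> (0 < b < N ^ 4)%N -> ilog Q a = ilog Q b -> a = b.
  move=> /andP[a0 aN] /andP[b0 bN] ab; have [h'|h'|//] := ltngtP a b.
    by have := mono a b a0 h' (ltnW (leq_trans bN NB)); rewrite ab ltnn.
  by have := mono b a b0 h' (ltnW (leq_trans aN NB)); rewrite ab ltnn.
(* S_N is truncation at degree L, and does not distinguish h from p *)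
have TE : take_poly L.+1 h = lift n (take_poly N p).
  apply/polyP => i; rewrite coef_take_poly /lift coef_sum; case: ltnP => iL.
    rewrite h1 // /f coef_sum; apply: eq_bigr => -[a an] _ /=.
    rewrite !coefZ coefXn coef_take_poly; case: ltnP => // Na.
    rewrite (_ : (i == _) = false) ?mulr0 //; apply/negbTE.
    by have := mono N a.+1 N0 Na (leq_trans an pB); rewrite -/L; lia.
  rewrite big1 // => -[a an] _ /=; rewrite coefZ coefXn coef_take_poly.
  case: ltnP => [aN|]; last by rewrite mul0r.
  rewrite (_ : (i == _) = false) ?mulr0 //; apply/negbTE.
  have : (ilog Q a.+1 <= L)%N by apply: monoW => //; lia.
  by lia.
(* the spectrum of h consists of the ilog Q a with a < N^2 *)
have hS : h = \sum_(a <- r) h`_(ilog Q a) *: 'X^(ilog Q a).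
  apply/polyP => i; rewrite coef_sum.
  have [/hasP[a ar /eqP ai]|/hasPn nr] := boolP (has (fun a => ilog Q a == i) r).
    rewrite (bigD1_seq a) ?iota_uniq //= coefZ coefXn ai eqxx mulr1.
    rewrite big1_seq ?addr0 // => b /andP[ba br]; rewrite coefZ coefXn.
    rewrite (_ : (i == _) = false) ?mulr0 //; apply/negbTE.
    apply: contra ba => /eqP ib; apply/eqP/inj; rewrite -?ib //.
      by move: br; rewrite rE; lia.
    by move: ar; rewrite rE; lia.
  rewrite big1_seq => [|b /= br]; last first.
    by rewrite coefZ coefXn eq_sym (negbTE (nr _ br)) mulr0.
  have [iL|iL] := leqP (2 * L) i; first by rewrite h0.
  apply: hf; rewrite /f /lift coef_sum big1 // => -[a an] _ /=.
  rewrite coefZ coefXn (_ : (i == _) = false) ?mulr0 //; apply/negP => /eqP ia.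
  have aN : (a.+1 < N ^ 2)%N.
    rewrite ltnNge; apply/negP => aN.
    have : (ilog Q (N ^ 2) <= ilog Q a.+1)%N by apply: monoW; lia.
    by rewrite ilogX // -ia -/L; lia.
  by have := nr a.+1; rewrite rE aN -ia eqxx => /(_ isT).
pose phi j := normc h.[z ^+ j].
have phi0 j : 0 <= phi j by apply: normc_ge0.
have phiE j : phi j = normc (\sum_(a <- r) h`_(ilog Q a) * z ^+ j ^+ ilog Q a).
  rewrite /phi {1}hS horner_sum; congr normc; apply: eq_bigr => a _.
  by rewrite hornerZ hornerXn.
have A20 : 0 <= A ^+ (2 ^ k.+1) by apply: exprn_ge0.
have phi24 : E (fun j => phi j ^+ 2) <= A ^+ (2 ^ k.+1) * E phi ^+ 2.
  apply: norm2_le_norm1 => //; rewrite N4 in inj hD.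
  apply: (@lifted_norm4_le r (fun a =>
    h`_(ilog Q a)) _ (N ^ 2)%N (iota_uniq _ _) _ inj _ hD phi phiE).
    by move=> a; rewrite -/r rE.
  move=> a /andP[a0 aN]; have : (ilog Q a <= ilog Q B)%N by apply: monoW => //; lia.
  by lia.
have [G [D [Dm sG] GE]] := trigval_laurent s0.
have k1 : (1 <= 2 ^ k)%N by rewrite expn_gt0.
set X := (Q * _).+1 in Qm Dm sG.
have Xk : (X <= X * 2 ^ k)%N by rewrite leq_pmulr.
have DM : (D < m)%N by lia.
have sh : (size h <= (ilog Q B).*2)%N.
  apply/leq_sizeP => i iB; apply: h0; lia.
have hGm : (size h + size G <= m)%N by lia.
(* the truncation of h at degree L, moved onto g *)
pose t := poly_tail (D.+1 - L.+1) G.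
pose gam j := normc t.[z ^+ j].
have gam0 j : 0 <= gam j by apply: normc_ge0.
have w1 := @normc_root _ _ _ m_gt0 z_prim.
have hchi := qchar_unimodular_root R Q.
have step1 : E (fun j => psi (qchar Q (z ^+ j))) <= E (fun j => phi j * gam j).
  have : (E (fun j => psi (qchar Q (z ^+ j))))%:C%C =
      E (fun j => h.[z ^+ j] * (t.[z ^+ j] * ((z ^+ j ^+ D)^*)%C)).
    rewrite -(truncation_duality m_gt0 z_prim _ hGm DM) -avg_real.
    apply: eq_avg => j; have [_ <- _] := hpsi _ (hchi j).
    by rewrite hg // GE TE horner_lift // size_take_poly_le.
  move=> /(congr1 (@normc R)); rewrite normc_real => eqn.
  apply: le_trans (ler_norm _) _; rewrite eqn.
  apply: le_trans (normc_avg _ _) _; apply: ler_avg => j.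
  by rewrite !normcM normc_conj normcX w1 expr1n mulr1.
have gamq : E (fun j => gam j ^+ (2 ^ k.+1)) <= (2 ^+ k.+1) ^+ (2 ^ k.+1).
  have sGk : (size G * 2 ^ k <= m)%N.
    by apply: leq_trans (_ : X * 2 ^ k <= m)%N; rewrite ?leq_mul2r ?sG ?orbT //; lia.
  apply: le_trans (Riesz_projection m_gt0 z_prim _ sGk) _.
  rewrite -[leRHS]mulr1; apply: ler_pM; rewrite ?exprn_ge0 //.
  - by apply: avg_ge0 => j; rewrite exprn_ge0 // normc_ge0.
  - apply: lerXn2r; rewrite ?nnegrE ?exprn_ge0 //.
    by rewrite -natrX ler_nat leq_pred.
  - rewrite -[leRHS](avg_cst m_gt0); apply: ler_avg => j.
    apply: exprn_ile1; first exact: normc_ge0.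
    have [g1 _ _] := hpsi _ (hchi j); move: g1; rewrite hg // GE normcM normc_conj.
    by rewrite normcX w1 expr1n mulr1.
have Ephi0 : 0 <= E phi by apply: avg_ge0.
have step2 : E (fun j => phi j * gam j) <= A * E phi * 2 ^+ k.+1.
  have Epg0 : 0 <= E (fun j => phi j * gam j).
    by apply: avg_ge0 => j; apply: mulr_ge0.
  have rhs0 : 0 <= A * E phi * 2 ^+ k.+1.
    by apply: mulr_ge0; [apply: mulr_ge0|apply: exprn_ge0].
  have q0 : (0 < 2 ^ k.+1)%N by rewrite expn_gt0.
  rewrite -(ler_pXn2r q0) ?nnegrE //.
  have H := avg_Hoelder m_gt0 k phi0 gam0 A20 phi24.
  move: (E phi) Ephi0 H => x x0 H; apply: le_trans H _; rewrite !exprMn;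
    apply: ler_wpM2l => //.
  by apply: mulr_ge0 => //; apply: exprn_ge0.
have hqp : E phi <= 2 * qnorm Q p.
  apply: le_trans hE _; rewrite ler_wpM2l // le_eqVlt; apply/orP; left; apply/eqP.
  by apply: eq_avg => j; rewrite horner_lift.
have step0 : qnorm Q (take_poly N p) - e <= E (fun j => psi (qchar Q (z ^+ j))).
  rewrite -[e](avg_cst m_gt0) /qnorm /qavg -avgB; apply: ler_avg => j.
  by have [] := hpsi _ (hchi j).
rewrite -lerBlDr; apply: le_trans step0 (le_trans step1 (le_trans step2 _)).
have -> : 2 * A * 2 ^+ k.+1 * qnorm Q p = A * (2 * qnorm Q p) * 2 ^+ k.+1 by ring.
by rewrite ler_wpM2r ?exprn_ge0 // ler_wpM2l.
Qed.

End Lift.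

(** * Properties of the norm and of partial sums *)

Section Seminorm.
Variable R : realType.
Local Notation C := R[i].
Implicit Types p q : dirpoly R.

Lemma dirpoly_norm_ge0 p : 0 <= dirpoly_norm p.
Proof.
apply: (ler_cvg_to (cvg_cst 0) (@qnorm_cvg R p)); apply: nearW => Q.
by apply: avg_ge0 => j; apply: normc_ge0.
Qed.

Lemma dirpoly_norm_triangle p q :
  dirpoly_norm (p + q) <= dirpoly_norm p + dirpoly_norm q.
Proof.
apply: (ler_cvg_to (@qnorm_cvg R (p + q)) (cvgD (@qnorm_cvg R p) (@qnorm_cvg R q))).
apply: nearW => Q; rewrite -[leRHS]/(qnorm Q p + qnorm Q q) -avgD;
  apply: ler_avg => j.
by rewrite dirvalD normcD_le.
Qed.

Lemma dirpoly_norm_opp p : dirpoly_norm (- p) = dirpoly_norm p.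
Proof.
apply: (cvg_unique (@Rhausdorff R) (@qnorm_cvg R (- p))).
rewrite (_ : (fun Q => qnorm Q (- p)) = (fun Q => qnorm Q p)); first exact: qnorm_cvg.
by apply/funext => Q; apply: eq_avg => j; rewrite dirvalN normc_opp.
Qed.

Lemma dirpoly_norm_dist p q :
  `|dirpoly_norm p - dirpoly_norm q| <= dirpoly_norm (p - q).
Proof.
have aux (x y : dirpoly R) : dirpoly_norm x <= dirpoly_norm y + dirpoly_norm (x - y).
  have xE : y + (x - y) = x by rewrite addrC subrK.
  by rewrite -{1}xE; apply: dirpoly_norm_triangle.
have h1 := aux p q; have := aux q p.
rewrite -(opprB p q) dirpoly_norm_opp => h2.
by rewrite ler_distl; apply/andP; split; lra.
Qed.

Lemma dirpoly_norm_le_coef p : dirpoly_norm p <= coef_norm1 p.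
Proof.
apply: (ler_cvg_to (@qnorm_cvg R p) (cvg_cst (coef_norm1 p))); apply: nearW => Q.
rewrite -[leRHS](avg_cst (qsize_gt0 Q)); apply: ler_avg => j.
exact/dirval_le/qchar_unimodular_root.
Qed.

Lemma coef_norm1_wide p n : (size p <= n)%N -> coef_norm1 p = \sum_(k < n) normc p`_k.
Proof.
move=> pn; rewrite /coef_norm1 (big_ord_widen _ (fun k => normc p`_k) pn).
rewrite big_mkcond; apply: eq_bigr => k _; case: ltnP => // h.
by rewrite nth_default // normc0.
Qed.

(** The coefficient is the mean of p(chi) conj(chi(k + 1)). *)
Lemma coef_le_dirpoly_norm p k : normc p`_k <= dirpoly_norm p.
Proof.
have [pk|kp] := leqP (size p) k.
  by rewrite nth_default // normc0 dirpoly_norm_ge0.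
pose s : seq (C * (nat * nat)) := [seq (p`_(nat_of_ord i), (i.+1, k.+1)) | i <-
  index_enum 'I_(size p)].
have s0 : posfreq s by rewrite /posfreq all_map; apply/allP.
have sE : trigmean s = p`_k.
  rewrite /trigmean /s big_map /= big_mkcond /= (bigD1 (Ordinal kp)) //= eqxx.
  rewrite big1 ?addr0 // => i ik; rewrite eqSS (_ : (_ == _) = false) //.
  by apply/negbTE; apply: contra ik => /eqP ik; apply/eqP/val_inj.
apply: (ler_cvg_to (cvg_cst (normc p`_k)) (@qnorm_cvg R p)).
apply: filterS (qavg_trigval s0) => Q hQ.
rewrite -sE -hQ; apply: le_trans (normc_avg _ _) _; apply: ler_avg => j.
set chi := qchar _ _; have hchi : unimodular_char chi by apply: qchar_unimodular_root.
rewrite (_ : trigval s chi = dirval p chi * ((chi k.+1)^*)%C).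
  by rewrite normcM normc_conj hchi.1 // mulr1.
rewrite /trigval big_map /dirval mulr_suml.
by apply: eq_bigr => i _; rewrite mulrA.
Qed.

(** [lifted_truncation_bound] as Q tends to infinity, then e to 0. *)
Lemma dirpoly_norm_take_le (N k : nat) p (A : R) : (1 < N)%N -> 0 <= A ->
  (forall l, (0 < l < N ^ 4)%N -> (size (divisors l))%:R <= A ^+ (2 ^ k.+1)) ->
  dirpoly_norm (take_poly N p) <= 2 * A * 2 ^+ k.+1 * dirpoly_norm p.
Proof.
move=> N1 A0 hD; apply/ler_addgt0Pr => e e0.
have [g [psi tg hg]] := sign_approx (take_poly N p) e0.
have [s s0 hs] := tg.
apply: (ler_cvg_to (@qnorm_cvg R (take_poly N p))
  (cvgD (cvgM (cvg_cst _) (@qnorm_cvg R p)) (cvg_cst e))).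
pose B := maxn (size p) (N ^ 4); pose c := (\sum_(x <- s) (x.2.1 + x.2.2))%N.
have B0 : (0 < B)%N by rewrite leq_max expn_gt0 (ltnW N1) orbT.
exists (maxn (B * 2 ^ B) (c.+1 * 2 ^ k + 4 * B.+1))%N => // Q /=.
rewrite geq_max => /andP[Q1 Q2].
have Q0 : (0 < Q)%N.
  by apply: leq_trans Q1; rewrite muln_gt0 B0 expn_gt0.
apply: (@lifted_truncation_bound _ _ Q0 N k B p A e g psi s) => //.
- by rewrite leq_maxl.
- by rewrite leq_maxr.
- exact: ltW.
- move=> a b a0 ab bB; apply: ilog_ltn => //; apply: leq_trans Q1.
  by apply: leq_mul; [lia|rewrite leq_exp2l].
- rewrite -/c /qsize; have := ilog_le Q B0; rewrite -mulnn.
  have : (0 < 2 ^ k)%N by rewrite expn_gt0.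
  move: (2 ^ k)%N (ilog Q B) Q2 => K I Q2 K0 IB.
  have : (Q.+1 * (c.+1 * K + 4 * B.+1) <= Q.+1 * Q.+1)%N.
    by rewrite leq_mul2l /=; lia.
  nia.
- by move=> chi hchi; have [h1 h2 /andP[h3 _]] := hg _ hchi.
Qed.

End Seminorm.

Section H1Facts.
Variable R : realType.
Local Notation C := R[i].

Lemma H1_norm_cvg (f : H1 R) : dirpoly_norm (H1_seq f k) @[k --> \oo] --> H1_norm f.
Proof.
have cv : cvgn (fun k => dirpoly_norm (H1_seq f k)).
  apply: cauchy_seq_cvg => e e0; have [K hK] := H1_seqP f e0.
  exists K => m n mK nK; exact: le_lt_trans (dirpoly_norm_dist _ _) (hK _ _ mK nK).
exact: cv.
Qed.

Lemma H1_norm_of_dirpoly (p : dirpoly R) : H1_norm (H1_of_dirpoly p) = dirpoly_norm p.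
Proof. exact: (@lim_cst R (@Rhausdorff R) nat \oo _ (dirpoly_norm p)). Qed.

Lemma H1_coef_of_dirpoly (p : dirpoly R) n : H1_coef (H1_of_dirpoly p) n.+1 = p`_n.
Proof. exact: (@lim_cst R[i]^o (@norm_hausdorff _ _) nat \oo _ p`_n). Qed.

Lemma Re_Im_cvg (u : nat -> C) (c : C) :
  complex.Re (u n) @[n --> \oo] --> complex.Re c ->
  complex.Im (u n) @[n --> \oo] --> complex.Im c ->
  (fun n => u n : C^o) @ \oo --> (c : C^o).
Proof.
move=> /cvgrPdist_lt hr /cvgrPdist_lt hi; apply/cvgrPdist_lt => e e0.
have eE : e = (complex.Re e)%:C%C by rewrite RRe_real // gtr0_real.
have r0 : 0 < complex.Re e by move: e0; rewrite {1}eE ltcR.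
have r20 : 0 < complex.Re e / 2 by lra.
apply: filterS2 (hr _ r20) (hi _ r20) => n h1 h2.
have -> : `|c - u n| = (normc (c - u n))%:C%C by [].
rewrite eE ltcR.
have -> : c - u n = (complex.Re (c - u n))%:C%C + 'i%C * (complex.Im (c - u n))%:C%C.
  exact: complexE.
apply: le_lt_trans (normcD_le _ _) _; rewrite normcM !normc_real.
have -> : normc ('i%C : C) = 1 by rewrite /normc /= expr0n expr1n add0r sqrtr1.
rewrite mul1r !raddfB; lra.
Qed.

Lemma H1_coef_cvg (f : H1 R) n :
  normc ((H1_seq f k)`_n - H1_coef f n.+1) @[k --> \oo] --> (0 : R).
Proof.
pose u k := (H1_seq f k)`_n.
have cau e : 0 < e -> exists K, forall i j, (K <= i)%N -> (K <= j)%N ->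
    normc (u i - u j) < e.
  move=> e0; have [K hK] := H1_seqP f e0; exists K => i j iK jK.
  apply: le_lt_trans (hK _ _ iK jK); rewrite /u -coefB; exact: coef_le_dirpoly_norm.
have cr : cvgn (fun k => complex.Re (u k)).
  apply: cauchy_seq_cvg => e /cau [K hK]; exists K => i j iK jK.
  apply: le_lt_trans (hK _ _ iK jK); rewrite -raddfB.
  rewrite ler_norml; apply/andP; split; last exact: Re_le_normc.
  by rewrite lerNl -raddfN -(normc_opp (u i - u j)); apply: Re_le_normc.
have ci : cvgn (fun k => complex.Im (u k)).
  apply: cauchy_seq_cvg => e /cau [K hK]; exists K => i j iK jK.
  apply: le_lt_trans (hK _ _ iK jK); rewrite -raddfB; exact: Im_le_normc.
pose c : C := (lim (complex.Re (u k) @[k --> \oo]) +i*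
   lim (complex.Im (u k) @[k --> \oo]))%C.
have uc := @Re_Im_cvg u c cr ci.
have -> : H1_coef f n.+1 = c := cvg_lim (@norm_hausdorff _ R[i]^o) uc.
move/cvgrPdist_lt : uc => uc; apply/cvgrPdist_lt => e e0.
have eC : 0 < e%:C%C by rewrite ltcR.
apply: filterS (uc _ eC) => k; have -> : `|c - u k| = (normc (c - u k))%:C%C by [].
by rewrite ltcR sub0r normrN ger0_norm ?normc_ge0 // -normc_opp opprB.
Qed.

(** By density: the partial sums of a Cauchy sequence representing f converge to
that of f, because their finitely many coefficients do. *)
Lemma partial_sum_le (N : nat) (K : R) (f : H1 R) :
  (forall p, dirpoly_norm (take_poly N p) <= K * dirpoly_norm p) ->
  H1_norm (partial_sum N f) <= K * H1_norm f.
Proof.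
move=> hK; rewrite H1_norm_of_dirpoly; set P := \poly_(k < N) _.
pose d k := \sum_(i < N) normc ((H1_seq f k)`_i - H1_coef f i.+1).
have dl : d k @[k --> \oo] --> (0 : R).
  rewrite (_ : 0 = \sum_(i < N) (0 : R)); last by rewrite big1.
  by apply: cvg_big => [|i _]; [exact: add_continuous|exact: H1_coef_cvg].
rewrite -[leRHS]addr0.
have c1 : (K * dirpoly_norm (H1_seq f k) + d k) @[k --> \oo] --> K * H1_norm f + 0.
  by apply: cvgD dl; apply: cvgM; [exact: cvg_cst|exact: H1_norm_cvg].
apply: (ler_cvg_to (cvg_cst (dirpoly_norm P)) c1).
apply: nearW => k; rewrite /=.
have -> : P = take_poly N (H1_seq f k) + (P - take_poly N (H1_seq f k)).
  by rewrite addrC subrK.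
apply: le_trans (dirpoly_norm_triangle _ _) (lerD (hK _) _).
apply: le_trans (dirpoly_norm_le_coef _) _; rewrite (@coef_norm1_wide _ _ N).
  apply: ler_sum => i _; rewrite coefB coef_poly coef_take_poly ltn_ord.
  by rewrite -normc_opp opprB.
apply/leq_sizeP => i Ni; rewrite coefB coef_poly coef_take_poly.
by rewrite ltnNge Ni /= subrr.
Qed.

End H1Facts.

(** * The sawtooth series *)

Section Sawtooth.
Variable R : realType.
Local Notation C := R[i].
Variable x : C.
Hypothesis x1 : normc x = 1.

Let xn n : normc (x ^+ n) = 1. Proof. by rewrite normcX x1 expr1n. Qed.

Lemma normc_nat_inv n : normc (n%:R^-1 : C) = n%:R^-1.
Proof. by rewrite normcV normc_nat. Qed.

Lemma normc_subXn l : normc (1 - x ^+ l) <= l%:R * normc (1 - x).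
Proof.
elim: l => [|l IH]; first by rewrite expr0 subrr normc0 mul0r.
have -> : 1 - x ^+ l.+1 = (1 - x ^+ l) + x ^+ l * (1 - x).
  by rewrite exprSr; ring.
apply: le_trans (normcD_le _ _) _; rewrite normcM xn mul1r -natr1 mulrDl mul1r.
by rewrite lerD2r.
Qed.

Lemma normc_sub_conj l : normc (x ^+ l - ((x ^+ l)^*)%C) <= 2 * l%:R * normc (1 - x).
Proof.
have -> : x ^+ l - ((x ^+ l)^*)%C = ((1 - x ^+ l)^*)%C - (1 - x ^+ l).
  by rewrite (rmorphB (@conjc R)) (rmorph1 (@conjc R)); ring.
apply: le_trans (normcB_le _ _) _; rewrite normc_conj.
by have := normc_subXn l; lra.
Qed.

(** Abel summation: (1 - x) times the sum is a combination of powers of x, with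
two boundary terms and the coefficients 1 / (l + 2) - 1 / (l + 1) in between,
which have constant sign and so telescope in absolute value. *)
Lemma log_tail_bound m M : (m <= M)%N ->
  normc (1 - x) * normc (\sum_(m <= l < M) x ^+ l.+1 / l.+1%:R) <= 2 / m.+1%:R.
Proof.
move=> mM; rewrite -normcM.
pose T n := (1 - x) * (\sum_(m <= l < n) x ^+ l.+1 / l.+1%:R)
  + x ^+ n.+1 / n.+1%:R.
have hT n : (m <= n)%N -> normc (T n) <= 2 / m.+1%:R - (n.+1%:R)^-1.
  elim: n => [|n IH].
    rewrite leqn0 => /eqP ->; rewrite /T big_geq // mulr0 add0r normcM xn.
    by rewrite normc_nat_inv; lra.
  rewrite leq_eqVlt => /orP[/eqP mn|].
    rewrite /T -mn big_geq // mulr0 add0r normcM xn normc_nat_inv.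
    by move: (m.+1%:R^-1 : R) => v; lra.
  rewrite ltnS => mn; have {IH} := IH mn.
  have n1 : (n.+1%:R : C) != 0 by rewrite pnatr_eq0.
  have n2 : (n.+2%:R : C) != 0 by rewrite pnatr_eq0.
  have -> : T n.+1 = T n + x ^+ n.+2 * (n.+2%:R^-1 - n.+1%:R^-1).
    rewrite /T big_nat_recr //= mulrDr.
    by rewrite [x ^+ n.+2]exprSr; ring.
  move=> IH; apply: le_trans (normcD_le _ _) _.
  rewrite normcM xn mul1r.
  have -> : (n.+2%:R^-1 - n.+1%:R^-1 : C) = (n.+2%:R^-1 - n.+1%:R^-1 : R)%:C%C.
    by rewrite rmorphB !fmorphV !rmorph_nat.
  rewrite normc_real ler0_norm ?opprB; last first.
    by rewrite subr_le0 lef_pV2 ?posrE ?ltr0n // ler_nat.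
  move: (n.+2%:R^-1 : R) (n.+1%:R^-1 : R) (m.+1%:R^-1 : R) (normc (T n)) IH.
  move=> u v w t. lra.
have -> : (1 - x) * (\sum_(m <= l < M) x ^+ l.+1 / l.+1%:R) =
  T M - x ^+ M.+1 / M.+1%:R by rewrite /T addrK.
apply: le_trans (normcB_le _ _) _; rewrite normcM xn normc_nat_inv.
have := hT _ mM.
move: (M.+1%:R^-1 : R) (m.+1%:R^-1 : R) (normc (T M)) => v w t; lra.
Qed.

(** Cut the sum at m ~ 1 / |1 - x|. Below m the l-th term is at most
2 |1 - x|, since |x^l - conj x^l| <= 2 l |1 - x|; above m the tail is controlled
by [log_tail_bound]. *)
Lemma sawtooth_bound M :
  normc (\sum_(0 <= l < M) (x ^+ l.+1 - ((x ^+ l.+1)^*)%C) / l.+1%:R) <= 6.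
Proof.
pose d := normc (1 - x); have d0 : 0 <= d by apply: normc_ge0.
have head n : normc (\sum_(0 <= l < n) (x ^+ l.+1 - ((x ^+ l.+1)^*)%C) / l.+1%:R)
    <= 2 * n%:R * d.
  apply: le_trans (normc_sum _ _ _) _.
  apply: le_trans (_ : \sum_(0 <= l < n) 2 * d <= _); last first.
    by rewrite sumr_const_nat subn0 -mulr_natr; lra.
  apply: ler_sum => l _; rewrite normcM normc_nat_inv ler_pdivrMr ?ltr0n //.
  by have := normc_sub_conj l.+1; rewrite -/d; lra.
have [d00|dn0] := eqVneq d 0.
  by apply: le_trans (head M) _; rewrite d00 mulr0.
have dp : 0 < d by rewrite lt0r dn0.
pose m := Num.truncn d^-1.
have md : m%:R * d <= 1.
  by rewrite -ler_pdivlMr // mul1r; have := truncn_le d^-1; rewrite invr_ge0 d0.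
have md1 : 1 < m.+1%:R * d.
  by rewrite -ltr_pdivrMr // mul1r truncnS_gt.
have [Mm|/ltnW mM] := leqP M m.
  apply: le_trans (head M) _; have : (M%:R : R) <= m%:R by rewrite ler_nat.
  by move=> h; have : M%:R * d <= m%:R * d; [rewrite ler_wpM2r|lra].
rewrite (big_cat_nat _ mM) //=; apply: le_trans (normcD_le _ _) _.
have h1 : normc (\sum_(0 <= l < m) (x ^+ l.+1 - ((x ^+ l.+1)^*)%C) / l.+1%:R) <= 2.
  by apply: le_trans (head m) _; lra.
set S := \sum_(m <= l < M) x ^+ l.+1 / l.+1%:R.
have h2 : \sum_(m <= l < M) (x ^+ l.+1 - ((x ^+ l.+1)^*)%C) / l.+1%:R = S - (S^*)%C.
  rewrite /S (rmorph_sum (@conjc R)) -sumrB; apply: eq_bigr => l _.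
  by rewrite (rmorphM (@conjc R)) (fmorphV (@conjc R)) (rmorph_nat (@conjc R)) mulrBl.
have h3 : normc S <= 2.
  have := log_tail_bound mM; rewrite -/S -/d => h.
  have h4 : 2 / m.+1%:R <= 2 * d.
    by rewrite ler_pdivrMr ?ltr0n // -mulrA ler_peMr // mulrC ltW.
  by rewrite -(ler_pM2l dp) [leRHS]mulrC; apply: le_trans h h4.
rewrite h2; have := normcB_le S (S^*)%C; rewrite normc_conj; lra.
Qed.

End Sawtooth.

(** * The lower bound *)

Section LowerBound.
Variable R : realType.
Local Notation C := R[i].

Lemma dirvalZ (c : C) (p : dirpoly R) chi : dirval (c *: p) chi = c * dirval p chi.
Proof.
rewrite (@dirval_wide _ _ _ (size p)) ?size_scale_leq // /dirval mulr_sumr.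
by apply: eq_bigr => k _; rewrite coefZ mulrA.
Qed.

Lemma dirvalXn k (chi : nat -> C) : dirval ('X^k : dirpoly R) chi = chi k.+1.
Proof.
rewrite (@dirval_wide _ _ _ k.+1) ?size_polyXn // big_ord_recr /= coefXn eqxx mul1r.
rewrite big1 ?add0r // => -[i ik] _ /=;
  rewrite coefXn (_ : (_ == _) = false) ?mul0r //.
by apply/negbTE; rewrite neq_ltn ik.
Qed.

Lemma dirval_sum (I : Type) (r : seq I) (F : I -> dirpoly R) chi :
  dirval (\sum_(i <- r) F i) chi = \sum_(i <- r) dirval (F i) chi.
Proof.
apply: (big_morph (fun p : dirpoly R => dirval p chi)).
  by move=> p q; apply: dirvalD.
by rewrite /dirval size_poly0 big_ord0.
Qed.

Lemma charX (chi : nat -> C) a n : unimodular_char chi -> (0 < a)%N ->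
  chi (a ^ n)%N = chi a ^+ n.
Proof.
move=> hchi a0; elim: n => [|n IH]; first by rewrite expn0 char1.
by rewrite expnS hchi.2 ?expn_gt0 ?a0 // IH exprS.
Qed.

(** The modulus of this square is a Fejer kernel in 2^(-it), so it has norm 1;
squaring, unlike taking the modulus, stays within Dirichlet polynomials. *)
Definition fejer_square n : dirpoly R :=
  (n.+1%:R)^-1 *: \sum_(a < n.+1) \sum_(b < n.+1) 'X^((2 ^ (a + b)).-1).

Lemma dirval_fejer_square n chi : unimodular_char chi ->
  dirval (fejer_square n) chi = (n.+1%:R)^-1 * (\sum_(a < n.+1) chi 2%N ^+ a) ^+ 2.
Proof.
move=> hchi; rewrite /fejer_square dirvalZ dirval_sum; congr (_ * _).
rewrite expr2 mulr_suml; apply: eq_bigr => a _.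
rewrite dirval_sum mulr_sumr; apply: eq_bigr => b _.
by rewrite dirvalXn prednK ?expn_gt0 // charX // exprD.
Qed.

Lemma ilog2_gt0 : \forall Q \near \oo, (0 < ilog Q 2)%N.
Proof.
by exists 4%N => // Q /= hQ; have := @ilog_ltn 1 2 Q isT isT hQ; rewrite ilog1.
Qed.

Lemma qavg_orth_powers2 n :
  \forall Q \near \oo, forall p q, (p <= n)%N -> (q <= n)%N ->
  qavg Q (fun chi : nat -> C => chi 2%N ^+ p * ((chi 2%N ^+ q)^*)%C) = (p == q)%:R.
Proof.
apply: filterS2 ilog2_gt0 (@ilog_lt_qsize 2%N n isT) => Q i2 lt p q pn qn.
rewrite /qavg.
rewrite (_ : avg _ _ = avg (qsize Q) (fun j => qroot R Q ^+ j ^+ (ilog Q 2 * p) *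
   ((qroot R Q ^+ j ^+ (ilog Q 2 * q))^*)%C)).
  rewrite (avg_orth (qsize_gt0 Q) (qroot_prim R Q)) ?eqn_pmul2l //; nia.
by apply: eq_avg => j; rewrite /qchar !(exprM _ (ilog Q 2)).
Qed.

Lemma dirpoly_norm_fejer_square n : dirpoly_norm (fejer_square n) = 1.
Proof.
apply: (cvg_unique (@Rhausdorff R) (@qnorm_cvg R (fejer_square n))).
apply: cvg_near_cst.
apply: filterS2 ilog2_gt0 (@ilog_lt_qsize 2%N n isT) => Q i2 lt.
have N0 : (n.+1%:R : R) != 0 by rewrite pnatr_eq0.
rewrite /qnorm /qavg (_ : avg _ _ = avg (qsize Q) (fun j => (n.+1%:R)^-1 *
   normc (\sum_(a <- index_enum 'I_n.+1) 1 * qroot R Q ^+ j ^+ (ilog Q 2 * a)) ^+ 2)).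
  rewrite avgZ (Parseval (qsize_gt0 Q) (qroot_prim R Q)).
  - by rewrite normc1 expr1n sumr_const card_ord mulVf.
  - exact: index_enum_uniq.
  - move=> a b _ _ /eqP; rewrite eqn_pmul2l // => /eqP; exact: val_inj.
  - move=> a _; have := ltn_ord a; nia.
apply: eq_avg => j; rewrite dirval_fejer_square; last exact: qchar_unimodular_root.
rewrite normcM normcX normcV normc_nat; congr (_ * normc _ ^+ 2).
by apply: eq_bigr => a _; rewrite mul1r /qchar exprM.
Qed.

Lemma take_fejer_square n N : (2 ^ n <= N < 2 ^ n.+1)%N ->
  take_poly N (fejer_square n) =
  (n.+1%:R)^-1 *: \sum_(a < n.+1) \sum_(b < n.+1 | (a + b <= n)%N)
     'X^((2 ^ (a + b)).-1).
Proof.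
move=> /andP[nN Nn]; apply/polyP => i; rewrite coef_take_poly /fejer_square !coefZ.
rewrite [X in if _ then X else _](_ : _ = (n.+1%:R)^-1 *
  \sum_(a < n.+1) \sum_(b < n.+1) (i == (2 ^ (a + b)).-1)%:R).
  rewrite [X in _ = _ * X](_ : _ =
    \sum_(a < n.+1) \sum_(b < n.+1 | (a + b <= n)%N) (i == (2 ^ (a + b)).-1)%:R).
    have small c : (c <= n)%N -> ((2 ^ c).-1 < N)%N.
      move=> cn; rewrite prednK ?expn_gt0 //; apply: leq_trans nN.
      by rewrite leq_exp2l.
    case: ltnP => iN.
      congr (_ * _); apply: eq_bigr => a _; rewrite [RHS]big_mkcond.
      apply: eq_bigr => b _; case: leqP => // nab.
      rewrite (_ : (_ == _) = false) //; apply/negbTE; rewrite neq_ltn.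
      apply/orP; left; apply: leq_trans iN _; rewrite -ltnS prednK ?expn_gt0 //.
      by apply: leq_trans Nn _; rewrite leq_exp2l.
    rewrite big1 ?mulr0 // => a _; rewrite big1 // => b /small h.
    rewrite (_ : (_ == _) = false) //; apply/negbTE; rewrite neq_ltn.
    by rewrite (leq_trans h iN) orbT.
  rewrite coef_sum; apply: eq_bigr => a _; rewrite coef_sum.
  by apply: eq_bigr => b _; rewrite coefXn.
congr (_ * _); rewrite coef_sum; apply: eq_bigr => a _; rewrite coef_sum.
by apply: eq_bigr => b _; rewrite coefXn.
Qed.

Lemma ln_succ_sub n : ln (n.+2%:R : R) - ln n.+1%:R <= (n.+1%:R)^-1.
Proof.
have h : n.+2%:R = n.+1%:R * (1 + n.+1%:R^-1) :> R.
  by rewrite mulrDr mulr1 mulfV ?pnatr_eq0 // natr1.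
rewrite h lnM ?posrE ?ltr0n ?ltr_wpDr ?invr_ge0 // addrC addKr.
by apply: le_ln1Dx; apply: lt_le_trans (_ : 0 <= _); rewrite ?invr_ge0 // ltrN10.
Qed.

Lemma ln_le_harmonic n : ln (n.+1%:R : R) <= \sum_(j < n) (j.+1%:R)^-1.
Proof.
elim: n => [|n IH]; first by rewrite ln1 big_ord0.
by rewrite big_ord_recr /=; have := ln_succ_sub n; move: (n.+1%:R^-1 : R) => v; lra.
Qed.

Lemma sum_ln_ge M : M%:R * (ln (M.+1%:R : R) - 1) <= \sum_(a < M) ln a.+2%:R.
Proof.
elim: M => [|M IH]; first by rewrite mul0r big_ord0.
rewrite big_ord_recr /=; apply: le_trans (lerD IH (lexx _)).
have h : M%:R * (ln (M.+2%:R : R) - ln M.+1%:R) <= 1.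
  apply: le_trans (_ : M%:R * (M.+1%:R)^-1 <= _).
    by rewrite ler_wpM2l // ln_succ_sub.
  by rewrite ler_pdivrMr ?ltr0n // mul1r ler_nat.
rewrite -[X in X * _ <= _]natr1;
  move: (ln M.+2%:R) (ln M.+1%:R) (M%:R) h => u v w; lra.
Qed.

(** After reversing both sums this is the mean of the harmonic numbers of order
1, ..., n + 1. *)
Lemma truncated_sum_ge n : ln (n.+2%:R : R) - 1 <= (n.+1%:R)^-1 *
  \sum_(a < n.+1) \sum_(b < n.+1 | (a + b <= n)%N) ((n.+1 - (a + b))%N%:R)^-1.
Proof.
rewrite ler_pdivlMl ?ltr0n //; apply: le_trans (sum_ln_ge _) _.
rewrite [leRHS](reindex_inj rev_ord_inj) /=; apply: ler_sum => -[a an] _ /=.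
apply: le_trans (ln_le_harmonic _) _.
rewrite (reindex_inj rev_ord_inj) /=.
rewrite (big_ord_widen_cond n.+1 xpredT (fun b => ((a.+1 - b.+1).+1%:R)^-1)) //=.
rewrite le_eqVlt; apply/orP; left; apply/eqP; apply: eq_big => -[b bn] /=.
  by apply/idP/idP; lia.
by move=> ba; congr (_%:R^-1); lia.
Qed.

Lemma dirpoly_norm_take_fejer_ge n N : (2 ^ n <= N < 2 ^ n.+1)%N ->
  (ln n.+2%:R - 1) / 6 <= dirpoly_norm (take_poly N (fejer_square n)).
Proof.
move=> nN.
apply: (ler_cvg_to (cvg_cst _) (@qnorm_cvg R (take_poly N (fejer_square n)))).
apply: filterS (@qavg_orth_powers2 (3 * n.+1)) => Q orth.
pose F chi := dirval (take_poly N (fejer_square n)) chi : C.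
pose saw (x : C) := \sum_(0 <= l < n.+1) (x ^+ l.+1 - ((x ^+ l.+1)^*)%C) / l.+1%:R.
(* after the shift by n.+1, the term of F of degree a + b meets only the index
   l = n - (a + b) of saw, and never the conjugate part of saw *)
pose W (chi : nat -> C) := ((chi 2%N ^+ n.+1)^*)%C * saw (chi 2%N).
have FE chi : unimodular_char chi -> F chi = (n.+1%:R)^-1 *
    \sum_(a < n.+1) \sum_(b < n.+1 | (a + b <= n)%N) chi 2%N ^+ (a + b).
  move=> hchi; rewrite /F take_fejer_square // dirvalZ dirval_sum; congr (_ * _).
  apply: eq_bigr => a _; rewrite -big_filter dirval_sum big_filter.
  by apply: eq_bigr => b _; rewrite dirvalXn prednK ?expn_gt0 // charX.
have pairing : qavg Q (fun chi => F chi * W chi) = ((n.+1%:R)^-1 *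
  \sum_(a < n.+1) \sum_(b < n.+1 | (a + b <= n)%N) ((n.+1 - (a + b))%N%:R)^-1 :
    R)%:C%C.
  rewrite rmorphM fmorphV rmorph_nat.
  rewrite (_ : qavg _ _ = qavg Q (fun chi : nat -> C => (n.+1%:R)^-1 *
     \sum_(a < n.+1) \sum_(b < n.+1 | (a + b <= n)%N) \sum_(0 <= l < n.+1)
       (l.+1%:R)^-1 * (chi 2%N ^+ (a + b + l.+1) * ((chi 2%N ^+ n.+1)^*)%C
          - chi 2%N ^+ (a + b) * ((chi 2%N ^+ (n.+1 + l.+1))^*)%C))); last first.
    apply: eq_avg => j; rewrite FE; last exact: qchar_unimodular_root.
    rewrite -mulrA; congr (_ * _); rewrite mulr_suml; apply: eq_bigr => a _.
    rewrite mulr_suml; apply: eq_bigr => b _.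
    rewrite /W /saw !mulr_sumr; apply: eq_bigr => l _.
    by rewrite !exprD !(rmorphM (@conjc R)); ring.
  rewrite /qavg avgZ rmorph_sum avg_sum; congr (_ * _); apply: eq_bigr => a _.
  rewrite rmorph_sum avg_sum; apply: eq_bigr => b ab.
  rewrite avg_sum fmorphV rmorph_nat.
  have orth' p q : (p <= 3 * n.+1)%N -> (q <= 3 * n.+1)%N ->
      avg (qsize Q) (fun j => qchar Q (qroot R Q ^+ j) 2%N ^+ p *
         ((qchar Q (qroot R Q ^+ j) 2%N ^+ q)^*)%C) = (p == q)%:R by apply: orth.
  rewrite (eq_big_nat _ _ (F2 := fun l => (l.+1%:R)^-1 * (l == (n - (a + b))%N)%:R)).
    have lt : (n - (a + b) < n.+1)%N by lia.
    rewrite (bigD1_seq (n - (a + b))%N) ?iota_uniq ?mem_index_iota //= eqxx mulr1.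
    rewrite big1 ?addr0 => [|l /negbTE ->]; last by rewrite mulr0.
    by congr (_%:R^-1); lia.
  move=> l /andP[_ ln]; rewrite avgZ avgB !orth'; [|lia..].
  congr (_ * _); rewrite (_ : (a + b + l.+1 == n.+1)%N = (l == n - (a + b))%N);
    last by lia.
  by rewrite (_ : (_ == (n.+1 + _)%N) = false) ?subr0 //; lia.
have bound : normc (qavg Q (fun chi =>
  F chi * W chi)) <= qnorm Q (take_poly N (fejer_square n)) * 6.
  apply: le_trans (normc_avg _ _) _; rewrite mulrC /qnorm /qavg -avgZ.
  apply: ler_avg => j; rewrite normcM mulrC ler_wpM2r ?normc_ge0 //.
  set chi := qchar _ _;
    have hchi : unimodular_char chi by apply: qchar_unimodular_root.
  rewrite /W normcM normc_conj normcX hchi.1 // expr1n mul1r.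
  by apply: sawtooth_bound; rewrite hchi.1.
rewrite ler_pdivrMr //; apply: le_trans bound; rewrite pairing normc_real.
by apply: le_trans (ler_norm _); apply: truncated_sum_ge.
Qed.

End LowerBound.

(** * The operator norm *)

Section OperatorNorm.
Variable R : realType.

Lemma opnorm_le N (K : R) : 0 <= K ->
  (forall p : dirpoly R, dirpoly_norm (take_poly N p) <= K * dirpoly_norm p) ->
  (H1_opnorm (@partial_sum R N) <= K%:E)%E.
Proof.
move=> K0 hK; apply: ge_ereal_sup => _ [f /= f1 <-]; rewrite lee_fin.
by apply: le_trans (partial_sum_le f hK) _; rewrite ler_piMr.
Qed.

Lemma opnorm_ge N (p : dirpoly R) : dirpoly_norm p <= 1 ->
  ((dirpoly_norm (take_poly N p))%:E <= H1_opnorm (@partial_sum R N))%E.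
Proof.
move=> p1; apply: ereal_sup_ubound; exists (H1_of_dirpoly p).
  by rewrite /= H1_norm_of_dirpoly.
rewrite H1_norm_of_dirpoly; congr (dirpoly_norm _)%:E; apply/polyP => i.
by rewrite coef_poly coef_take_poly H1_coef_of_dirpoly.
Qed.

Lemma opnorm_upper : exists2 C : R, 0 < C & \forall N \near \oo,
  (H1_opnorm (@partial_sum R N) <= (C * (ln (N%:R : R) / ln (ln (N%:R : R))))%:E)%E.
Proof.
have [c c0 hc] := size_divisors_bound R.
exists (4 * expR c); first by rewrite mulr_gt0 // expR_gt0.
near=> N.
have L3 : expR 1 <= ln (N%:R : R) by near: N; apply: ln_nat_near.
have hD : forall k, (0 < k < N ^ 4)%N ->
    (size (divisors k))%:R <= expR (c * (ln (N%:R : R) / ln (ln (N%:R :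
      R)))) by near: N.
have N1 : (1 < N)%N by near: N; exists 2%N.
set L := ln N%:R in L3 hD *; set y := L / ln L in hD *.
have Lp : 0 < L by apply: lt_le_trans L3; apply: expR_gt0.
have lL : 1 <= ln L by rewrite -[1]expRK ler_ln ?posrE ?expR_gt0.
have y1 : 1 <= y.
  by rewrite /y ler_pdivlMr ?mul1r; [exact: ln_le_self|exact: lt_le_trans lL].
pose t := Num.truncn y; have ty : t%:R <= y.
  by rewrite /t truncn_le; apply: le_trans y1.
have t0 : (0 < t)%N by rewrite truncn_gt0.
have yt : y < t.+1%:R := truncnS_gt y.
(* the exponent q = 2 ^ k.+1 satisfies y <= q <= 2 y *)
pose k := trunc_log 2 t.
have /andP[k1 k2] := trunc_log_bounds (isT : (1 < 2)%N) t0.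
have qy : y <= (2 ^ k.+1)%:R.
  by apply: le_trans (ltW yt) _; rewrite ler_nat.
have q2y : 2 ^+ k.+1 <= 2 * y.
  rewrite exprS ler_wpM2l //; apply: le_trans ty; rewrite -natrX ler_nat.
  exact: k1.
have ec : 0 <= expR c by apply: expR_ge0.
apply: le_trans (opnorm_le (K := 2 * expR c * 2 ^+ k.+1) _ _) _.
- by apply: mulr_ge0; [apply: mulr_ge0|apply: exprn_ge0].
- move=> p; apply: dirpoly_norm_take_le => // l /hD h; apply: le_trans h _.
  rewrite -expRM_natl ler_expR mulrC ler_wpM2r //; exact: ltW.
- rewrite lee_fin (_ : 4 * expR c * y = 2 * expR c * (2 * y)); last by ring.
  by rewrite ler_wpM2l // mulr_ge0.
Unshelve. all: by end_near.
Qed.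

Lemma opnorm_lower : \forall N \near \oo,
  ((12^-1 * ln (ln (N%:R : R)))%:E <= H1_opnorm (@partial_sum R N))%E.
Proof.
near=> N.
have L2 : expR 2 <= ln (N%:R : R) by near: N; apply: ln_nat_near.
have N0 : (0 < N)%N by near: N; exists 1%N.
have Lp : 0 < ln (N%:R : R) by apply: lt_le_trans L2; apply: expR_gt0.
have lL : 2 <= ln (ln (N%:R : R)) by rewrite -[leLHS]expRK ler_ln ?posrE ?expR_gt0.
pose n := trunc_log 2 N.
have nN := trunc_log_bounds (isT : (1 < 2)%N) N0.
have lnN : ln (ln (N%:R : R)) <= ln n.+2%:R.
  rewrite ler_ln ?posrE ?ltr0n //; apply: le_trans (_ : n.+1%:R <= _);
    last by rewrite ler_nat.
  apply: le_trans (_ : ln (2 ^ n.+1)%:R <= _).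
    rewrite ler_ln ?posrE ?ltr0n ?expn_gt0 // ler_nat ltnW //.
    by have /andP[] := nN.
  rewrite natrX lnXn // -[leRHS]mul1r -[leLHS]mulr_natr ler_wpM2r //.
  by have /andP[] := ln2_bounds R.
have f1 : dirpoly_norm (fejer_square R n) <= 1 by rewrite dirpoly_norm_fejer_square.
apply: le_trans (opnorm_ge N f1); rewrite lee_fin.
apply: le_trans (dirpoly_norm_take_fejer_ge R nN).
lra.
Unshelve. all: by end_near.
Qed.

End OperatorNorm.

Theorem theorem5p2 (R : realType) :
  exists c C : R, 0 < c /\ 0 < C /\
    \forall N \near \oo,
      ((c * ln (ln (N%:R : R)))%:E <= H1_opnorm (@partial_sum R N))%E /\
      (H1_opnorm (@partial_sum R N)
         <= (C * (ln (N%:R : R) / ln (ln (N%:R : R))))%:E)%E.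
Proof.
have [C C0 up] := opnorm_upper R.
exists 12^-1, C; split; first by rewrite invr_gt0.
by split=> //; apply: filterS2 (opnorm_lower R) up.
Qed.
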